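(* Let $n\ge 1$, let $H\in C^2(\mathbb{R}^n)$ have positive definite Hessian $H_{pp}(p)$ for every $p\in\mathbb{R}^n$ and satisfy $\lim_{|p|\to\infty} H(p)/|p|=+\infty$, and let $T>0$. Let $u_T\in \mathrm{Lip}(\mathbb{R}^n)$ be such that $I_T(u_T):=\{u_0\in \mathrm{Lip}(\mathbb{R}^n) : S_T^+u_0=u_T\}$ is nonempty, and set $\tilde u_0:=S_T^-u_T$. Then for any $u_0\in\mathrm{Lip}(\mathbb{R}^n)$ the following two statements are equivalent: (i) $u_0\in I_T(u_T)$; (ii) $u_0(x)\ge\tilde u_0(x)$ for all $x\in\mathbb{R}^n$, and $u_0(x)=\tilde u_0(x)$ for all $x\in X_T(u_T)$, where $$X_T(u_T):=\{z-T\,H_p(\nabla u_T(z)) : z\in\mathbb{R}^n\text{ such that }u_T\text{ is differentiable at }z\}.$$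
   Context: $\mathrm{Lip}(\mathbb{R}^n)$ is the set of (globally) Lipschitz continuous functions $\mathbb{R}^n\to\mathbb{R}$; $H_p$ is the gradient of $H$. Viscosity solution: for continuous $F:\mathbb{R}^n\to\mathbb{R}$, a uniformly continuous $u:[0,T]\times\mathbb{R}^n\to\mathbb{R}$ is a viscosity solution of $\partial_t u+F(D_xu)=0$ if for every $\varphi\in C^\infty([0,T]\times\mathbb{R}^n)$ and $(t_0,x_0)\in(0,T)\times\mathbb{R}^n$: $\partial_t\varphi(t_0,x_0)+F(\nabla_x\varphi(t_0,x_0))\le 0$ whenever $(t_0,x_0)$ is a local maximum of $u-\varphi$, and $\ge 0$ whenever it is a local minimum of $u-\varphi$. Backward viscosity solution: $w$ is a backward viscosity solution of $\partial_t w+H(D_xw)=0$ in $[0,T]\times\mathbb{R}^n$ if $v(t,x):=w(T-t,x)$ is a viscosity solution of $\partial_t v-H(D_xv)=0$. For $u_0\in\mathrm{Lip}(\mathbb{R}^n)$, $S_T^+u_0:=u(T,\cdot)\in\mathrm{Lip}(\mathbb{R}^n)$, where $u$ is the unique viscosity solution of $\partial_tu+H(D_xu)=0$ with $u(0,\cdot)=u_0$. For $u_T\in\mathrm{Lip}(\mathbb{R}^n)$, $S_T^-u_T:=w(0,\cdot)\in\mathrm{Lip}(\mathbb{R}^n)$, where $w$ is the unique backward viscosity solution of $\partial_tw+H(D_xw)=0$ with $w(T,\cdot)=u_T$. With $L(q)=\max_{p\in\mathbb{R}^n}[q\cdot p-H(p)]$, these operators are given by the well-known representation formulas $$S_T^+u_0(x)=\min_{y\in\mathbb{R}^n}\Big[u_0(y)+T\,L\Big(\frac{x-y}{T}\Big)\Big],\qquad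 S_T^-u_T(x)=\max_{y\in\mathbb{R}^n}\Big[u_T(y)-T\,L\Big(\frac{y-x}{T}\Big)\Big].$$ *)

(* Defs.v *)
From HB Require Import structures.
From mathcomp Require Import all_boot all_order all_algebra.
From mathcomp Require Import all_classical all_reals all_analysis.

Set Implicit Arguments.
Unset Strict Implicit.
Unset Printing Implicit Defensive.

Import Order.TTheory GRing.Theory Num.Theory.
Import numFieldNormedType.Exports.

Local Open Scope classical_set_scope.
Local Open Scope ring_scope.

(* The library norm on 'rV[R]_n is the sup norm; it is used only for topological
   and Lipschitz notions, which do not depend on the choice of a norm. *)

Section calculus.
Context {R : realType}.

Fixpoint Ck (k : nat) {V : normedModType R} (f : V -> R) : Prop :=
  if k is j.+1 then
    (forall x, differentiable f x) /\ (forall v, Ck j (fun x => 'D_v f x))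
  else continuous f.

Definition Cinfty {V : normedModType R} (f : V -> R) : Prop :=
  forall k, Ck k f.

Definition unif_continuous_on {V : normedModType R} (A : set V) (f : V -> R) :=
  forall e : R, 0 < e -> exists2 d : R, 0 < d &
    forall x y, A x -> A y -> `|x - y| < d -> `|f x - f y| < e.

Definition grad {n} (f : 'rV[R]_n -> R) (x : 'rV[R]_n) : 'rV[R]_n :=
  \row_i 'D_(delta_mx 0 i) f x.

Definition hessian {n} (f : 'rV[R]_n -> R) (x : 'rV[R]_n) : 'M[R]_n :=
  \matrix_(i, j) 'D_(delta_mx 0 j) (fun y => 'D_(delta_mx 0 i) f y) x.

Definition posdefmx {n} (A : 'M[R]_n) : Prop :=
  forall v : 'rV[R]_n, v != 0 -> 0 < (v *m A *m v^T) 0 0.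

Definition enorm {n} (p : 'rV[R]_n) : R := Num.sqrt (\sum_i p 0 i ^+ 2).

Definition superlinear {n} (f : 'rV[R]_n -> R) : Prop :=
  forall A : R, exists M : R, forall p, M < enorm p -> A < f p / enorm p.

End calculus.

Section hamilton_jacobi.
Context {R : realType} {n : nat}.
Implicit Types (F H : 'rV[R]_n -> R) (T : R).

Definition strip T : set (R * 'rV[R]_n) := [set z | 0 <= z.1 <= T].

(* Functions on [0, T] x R^n are represented by total functions on R x R^n whose
   values off the strip play no role, and C^oo([0, T] x R^n) by the restrictions
   of C^oo functions on R x R^n.  As 0 < t0 < T, a neighbourhood of (t0, x0) in
   R x R^n is, up to shrinking, one in [0, T] x R^n. *)
Definition viscosity_solution F T (u : R * 'rV[R]_n -> R) : Prop :=
  unif_continuous_on (strip T) u /\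
  forall (phi : R * 'rV[R]_n -> R) (t0 : R) (x0 : 'rV[R]_n),
    Cinfty phi -> 0 < t0 < T ->
    let pde := derive1 (fun t => phi (t, x0)) t0
               + F (grad (fun x => phi (t0, x)) x0) in
    ((\forall z \near (t0, x0), u z - phi z <= u (t0, x0) - phi (t0, x0)) ->
       pde <= 0) /\
    ((\forall z \near (t0, x0), u (t0, x0) - phi (t0, x0) <= u z - phi z) ->
       0 <= pde).

Definition backward_viscosity_solution H T (w : R * 'rV[R]_n -> R) : Prop :=
  viscosity_solution (fun p => - H p) T (fun z => w (T - z.1, z.2)).

(* The solutions selected below are unique on the strip, hence so are the values
   at times T and 0; the default value [cst 0] is never used for the Lipschitz
   data and Hamiltonians considered here, as solutions then exist. *)
Definition Splus H T (u0 : 'rV[R]_n -> R) : 'rV[R]_n -> R :=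
  let u := xget (cst 0) [set u | viscosity_solution H T u /\
                                 forall x, u (0, x) = u0 x] in
  fun x => u (T, x).

Definition Sminus H T (uT : 'rV[R]_n -> R) : 'rV[R]_n -> R :=
  let w := xget (cst 0) [set w | backward_viscosity_solution H T w /\
                                 forall x, w (T, x) = uT x] in
  fun x => w (0, x).

Definition initial_data H T (uT : 'rV[R]_n -> R) : set ('rV[R]_n -> R) :=
  [set u0 | lipschitz u0 /\ Splus H T u0 = uT].

Definition contact_set H T (uT : 'rV[R]_n -> R) : set 'rV[R]_n :=
  [set z - T *: grad H (grad uT z) | z in [set z | differentiable uT z]].

End hamilton_jacobi.

(* Main.v *)
(* For Lipschitz data [Splus] and [Sminus] are given by the Hopf-Lax formulas; this follows from a
   comparison principle (doubling of variables) and from checking that the Hopf-Lax function is a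
   viscosity solution.  With L the conjugate of H and uT = Splus v, the maximum formula for [Sminus]
   gives Sminus uT <= v.  If uT is differentiable at z, any minimiser y of v(y) + T L((z - y) / T)
   satisfies y = z - T H_p(grad uT(z)), so at such a y the values v(y) and Sminus uT(y) coincide.
   Conversely, if u0 dominates Sminus uT and agrees with it on the contact set, then
   Splus u0 >= uT everywhere and Splus u0 <= uT wherever uT is differentiable.  Rademacher's theorem
   is avoided: uT is differentiable at every point where it is touched from below by a paraboloid,
   and these points are dense. *)

(* [Splus] and [Sminus] are picked by [xget] among viscosity solutions, so neither can be evaluated
   before existence and uniqueness are both established. Uniqueness concerns possibly unbounded
   functions on a noncompact space and uses only continuity of the Hamiltonian: since it depends on
   the gradient alone, the penalisation parameter of the doubling can stay fixed. The backward
   problem is the forward one for H(-p) and datum -uT, so a single Hopf-Lax theory serves both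
   operators. Biconjugation is avoided: the viscosity inequalities need only Fenchel's inequality
   and its equality case at the slope H_p(p). Strict convexity of H yields the first-order upper
   bound on L that touches uT from above. Nonemptiness of I_T enters twice: writing uT = Splus v
   provides that upper bound for uT, and the minimisers for v are the contact points at which u0 can
   be compared with v. *)
Require Import Defs.
From HB Require Import structures.
From mathcomp Require Import all_boot all_order all_algebra.
From mathcomp Require Import all_classical all_reals all_analysis.
From mathcomp Require Import ring lra.
Import Order.TTheory GRing.Theory Num.Theory.
Import numFieldNormedType.Exports.
Local Open Scope classical_set_scope.
Local Open Scope ring_scope.

Set Implicit Arguments.
Unset Strict Implicit.
Unset Printing Implicit Defensive.

(** * Dot product and directional derivatives *)

Section dot_product.
Context {R : realType} {n : nat}.
Implicit Types (u v w : 'rV[R]_n) (a : R).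

Definition dot u v : R := \sum_i u 0 i * v 0 i.

Lemma dotC u v : dot u v = dot v u.
Proof. by apply: eq_bigr => i _; rewrite mulrC. Qed.

Lemma dotDl u v w : dot (u + v) w = dot u w + dot v w.
Proof. by rewrite -big_split; apply: eq_bigr => i _; rewrite mxE mulrDl. Qed.

Lemma dotZl a u v : dot (a *: u) v = a * dot u v.
Proof. by rewrite mulr_sumr; apply: eq_bigr => i _; rewrite mxE mulrA. Qed.

Lemma dotNl u v : dot (- u) v = - dot u v.
Proof. by rewrite -scaleN1r dotZl mulN1r. Qed.

Lemma dotBl u v w : dot (u - v) w = dot u w - dot v w.
Proof. by rewrite dotDl dotNl. Qed.

Lemma dotDr u v w : dot w (u + v) = dot w u + dot w v.
Proof. by rewrite dotC dotDl !(dotC w). Qed.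

Lemma dotZr a u v : dot u (a *: v) = a * dot u v.
Proof. by rewrite dotC dotZl dotC. Qed.

Lemma dotNr u v : dot u (- v) = - dot u v.
Proof. by rewrite dotC dotNl dotC. Qed.

Lemma dotBr u v w : dot w (u - v) = dot w u - dot w v.
Proof. by rewrite dotDr dotNr. Qed.

Lemma dot0l u : dot 0 u = 0.
Proof. by rewrite -(scale0r u) dotZl mul0r. Qed.

Lemma dot0r u : dot u 0 = 0.
Proof. by rewrite dotC dot0l. Qed.

Lemma coord_le_norm u i : `|u 0 i| <= `|u|.
Proof.
rewrite [leRHS]mx_normrE; apply: (le_bigmax _ (fun ij => `|u ij.1 ij.2|) (0, i)).
Qed.

Lemma dot_le_norm u v : `|dot u v| <= n%:R * `|u| * `|v|.
Proof.
apply: (le_trans (ler_norm_sum _ _ _)).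
have -> : n%:R * `|u| * `|v| = \sum_(i < n) `|u| * `|v|.
  by rewrite sumr_const card_ord -mulrA mulr_natl.
rewrite ler_sum// => i _.
by rewrite normrM ler_pM// coord_le_norm.
Qed.

Lemma norm_le_dot u : `|u| ^+ 2 <= dot u u.
Proof.
have dot_ge0 : 0 <= dot u u by apply: sumr_ge0 => i _; rewrite -expr2 sqr_ge0.
have [->|/mx_norm_neq0[[i j] /= uE]] := eqVneq `|u| 0; first by rewrite expr0n.
rewrite [`|u|]uE (ord1 i) real_normK ?num_real// /dot (bigD1 j)//= -expr2 lerDl.
by apply: sumr_ge0 => k _; rewrite -expr2 sqr_ge0.
Qed.

Lemma dot_ge0 u : 0 <= dot u u.
Proof. exact: le_trans (norm_le_dot u). Qed.

Lemma dot_gt0 u : u != 0 -> 0 < dot u u.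
Proof.
by move=> u0; apply: lt_le_trans (norm_le_dot u); rewrite exprn_gt0 ?normr_gt0.
Qed.

Lemma dot_enorm u : enorm u ^+ 2 = dot u u.
Proof.
rewrite sqr_sqrtr; first by apply: eq_bigr => i _; rewrite expr2.
by apply: sumr_ge0 => i _; rewrite sqr_ge0.
Qed.

Lemma norm_le_enorm u : `|u| <= enorm u.
Proof.
by rewrite -(@ler_pXn2r _ 2)// ?nnegrE ?sqrtr_ge0// dot_enorm norm_le_dot.
Qed.

Lemma continuous_dot v : continuous (dot^~ v).
Proof.
move=> u; apply: cvg_big => [||i _]; first exact: add_continuous.
  exact: nbhs_filter.
exact: cvgMr_tmp (@coord_continuous _ _ _ 0 i u).
Qed.

Lemma continuous_dotr v : continuous (dot v).
Proof.
have -> : dot v = dot^~ v by apply/funext => u; rewrite dotC.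
exact: continuous_dot.
Qed.

End dot_product.

Section directional_derivatives.
Context {R : realType}.

Lemma deriv_dot {n} (f : 'rV[R]_n -> R) x v :
  differentiable f x -> 'D_v f x = dot (grad f x) v.
Proof.
move=> df; rewrite deriveE// {1}(row_sum_delta v) linear_sum.
by apply: eq_bigr => i _; rewrite linearZ/= mxE deriveE// mulrC.
Qed.

(** Small positive [h] suffice: the estimates that feed it follow rays backward in time, or convex
    combinations with weight [h]. *)
Lemma derive_le {V : normedModType R} (f : V -> R) x v c :
  derivable f x v ->
  (\forall h \near 0^'+, f (x + h *: v) <= f x + h * c) -> 'D_v f x <= c.
Proof.
move=> df fc.
rewrite /derive cvg_at_rightE//.
apply: limr_le; first by apply/cvg_ex; exists ('D_v f x); apply: cvg_dnbhs_at_right.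
near=> h.
have h0 : 0 < h by [].
change (h^-1 * (f (h *: v + x) - f x) <= c).
rewrite mulrC ler_pdivrMr// mulrC lerBlDl [_ + x]addrC mulrC.
by rewrite mulrC; near: h.
Unshelve. all: by end_near. Qed.

(** The test functions are exactly quadratic along spatial lines, so an algebraic expansion replaces
    differentiation of [dot]. *)
Lemma is_derive_quadratic {V : normedModType R} (f : V -> R) x v b c :
  (forall h, f (x + h *: v) = f x + h * b + h ^+ 2 * c) -> is_derive x v f b.
Proof.
move=> fE.
have cv : h^-1 *: ((f \o shift x) (h *: v) - f x) @[h --> 0^'] --> b.
  have lin : b + h * c @[h --> 0^'] --> b.
    have -> : b = b + 0 * c by rewrite mul0r addr0.
    apply: cvgD; first by rewrite mul0r addr0; exact: cvg_cst.
    by apply: cvgMr_tmp; apply: cvg_within_filter; exact: cvg_id.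
  apply: cvg_trans lin.
  apply: near_eq_cvg; near=> h.
  have h0 : h != 0 by near: h; exact: nbhs_dnbhs_neq.
  change (b + h * c = h^-1 * (f (h *: v + x) - f x)).
  by rewrite [_ + x]addrC fE; field.
apply: DeriveDef; first by apply/cvg_ex; exists b.
exact: cvg_lim.
Unshelve. all: by end_near. Qed.

End directional_derivatives.

Section lipschitz_functions.
Context {R : realType} {V : normedModType R}.

Lemma continuous_epsdelta (f : V -> R) :
  (forall x e, 0 < e -> exists2 d, 0 < d & forall y, `|x - y| < d -> `|f x - f y| < e) ->
  continuous f.
Proof.
move=> fe x; apply/cvgrPdist_lt => e /(fe x)[d d0 fd].
by apply/nbhs_normP; exists d.
Qed.

Lemma lipschitz_bound {W : normedModType R} (f : V -> W) : lipschitz f ->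
  exists2 K, 0 <= K & forall x y, `|f x - f y| <= K * `|x - y|.
Proof.
move=> [M [_ HM]]; exists (Num.max 0 M + 1); first by rewrite addr_ge0// le_max lexx.
have MM : M < Num.max 0 M + 1.
  by apply: (@le_lt_trans _ _ (Num.max 0 M)); rewrite ?le_max ?lexx ?orbT// ltrDl.
by move=> x y; exact: (HM _ MM (x, y)).
Qed.

Variables (f : V -> R) (K : R).
Hypotheses (K_ge0 : 0 <= K) (f_lip : forall x y, `|f x - f y| <= K * `|x - y|).

Lemma lipschitz_le x y : f x <= f y + K * `|x - y|.
Proof. by rewrite -lerBlDl; apply: le_trans (ler_norm _) (f_lip _ _). Qed.

Lemma lipschitz_continuous : continuous f.
Proof.
apply: continuous_epsdelta => x e e0; have K1 : 0 < K + 1 by rewrite ltr_wpDl.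
exists (e / (K + 1)); first by rewrite divr_gt0.
move=> y; rewrite ltr_pdivlMr// => xy; apply: le_lt_trans (f_lip _ _) _.
by apply: le_lt_trans xy; rewrite mulrC ler_wpM2l// lerDl.
Qed.

End lipschitz_functions.

(** * Compactness and smooth test functions *)

Section compactness.
Context {R : realType} {n : nat}.

Lemma compact_norm_le r : compact [set p : 'rV[R]_n | `|p| <= r].
Proof.
apply: bounded_closed_compact; first by exists r; split=> [|M rM p /= pr];
  rewrite ?num_real// (le_trans pr)// ltW.
apply: (@closed_comp _ _ _ [set x | x <= r]); last exact: closed_le.
by move=> p _; exact: norm_continuous.
Qed.

Lemma coercive_min (f : 'rV[R]_n -> R) r : continuous f ->
  (forall p, r < `|p| -> f 0 <= f p) -> exists p, forall p', f p <= f p'.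
Proof.
move=> fc fr; have r0 : 0 <= Num.max r 0 by rewrite le_max lexx orbT.
have [||p _ pmin] := compact_EVT_min _ (@compact_norm_le (Num.max r 0)) (f := f).
- by exists 0 => /=; rewrite normr0.
- exact: continuous_subspaceT.
exists p => p'; have [p'r|] := leP `|p'| (Num.max r 0).
  by apply: pmin; rewrite inE.
rewrite gt_max => /andP[/fr + _]; apply: le_trans.
by apply: pmin; rewrite inE /= normr0.
Qed.

(** Only [p] is confined to the ball, since the doubling bounds one of the two gradients it
    compares. A covering of the ball by neighbourhoods of half the continuity radius leaves [p']
    free. *)
Lemma unif_continuous_ball (F : 'rV[R]_n -> R) r e : continuous F -> 0 < e ->
  exists2 d, 0 < d & forall p p', `|p| <= r -> `|p' - p| < d -> `|F p' - F p| < e.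
Proof.
move=> Fc e0.
have [d /= d0 dP] : \forall d \near 0^'+, [set p : 'rV[R]_n | `|p| <= r] `<=`
    [set p | forall p', `|p' - p| < d -> `|F p' - F p| < e].
  apply: (compact_near_coveringP _).1; first exact: compact_norm_le.
  move=> p _ /=.
  have e20 : 0 < e / 2 by rewrite divr_gt0.
  have /cvgrPdist_lt/(_ _ e20) /nbhs_normP[d /= d0 dP] := Fc p.
  have nearp : \forall p0 \near p, `|p - p0| < d / 2.
    by apply/nbhs_normP; exists (d / 2); rewrite //= divr_gt0.
  near=> p0 h => p' p'h.
  have p0d : `|p - p0| < d / 2 by near: p0.
  have hd : h < d / 2 by near: h; apply: nbhs_right_lt; rewrite divr_gt0.
  have -> : F p' - F p0 = (F p - F p0) - (F p - F p') by ring.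
  rewrite (splitr e) (le_lt_trans (ler_normB _ _))// ltrD//; apply: dP => /=.
    by apply: (lt_trans p0d); lra.
  rewrite -(subrK p0 p) -addrA (le_lt_trans (ler_normD _ _))//.
  by rewrite (splitr d) ltrD// distrC (lt_trans p'h).
exists (d / 2); first by rewrite divr_gt0.
move=> p p' pr p'p; apply: (dP (d / 2)) => //=; last by rewrite divr_gt0.
by rewrite sub0r normrN gtr0_norm ?divr_gt0// ltr_pdivrMr// ltr_pMr// ltr1n.
Unshelve. all: by end_near. Qed.

End compactness.

Section smooth_functions.
Context {R : realType} {V : normedModType R}.
Implicit Types f g : V -> R.

Lemma eq_Ck k f g : Ck k f -> f =1 g -> Ck k g.
Proof. by move=> + /funext <-. Qed.

Lemma Ck_cst k (c : R) : Ck k (fun _ : V => c).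
Proof.
elim: k c => [|k IH] c /=; first by move=> x; exact: cvg_cst.
split=> [x|v]; first exact: differentiable_cst.
by apply: (eq_Ck (IH 0)) => x; rewrite derive_cst.
Qed.

Lemma CkW k f : Ck k.+1 f -> Ck k f.
Proof.
elim: k f => [|k IH] f [fd fD].
  by move=> x; apply: differentiable_continuous.
by split=> // v; exact/IH/fD.
Qed.

Lemma CkD k f g : Ck k f -> Ck k g -> Ck k (f + g).
Proof.
elim: k f g => [|k IH] f g; first by move=> fc gc x; apply: cvgD; [exact: fc|exact: gc].
move=> [fd fD] [gd gD]; split=> [x|v]; first exact: differentiableD.
apply: (eq_Ck (IH _ _ (fD v) (gD v))) => x.
by rewrite deriveD//; apply: diff_derivable.
Qed.

Lemma CkM k f g : Ck k f -> Ck k g -> Ck k (f * g).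
Proof.
elim: k f g => [|k IH] f g; first by move=> fc gc x; apply: cvgM; [exact: fc|exact: gc].
move=> Hf Hg; have [[fd fD] [gd gD]] := (Hf, Hg); split=> [x|v].
  exact: differentiableM.
apply: (eq_Ck (CkD (IH _ _ (CkW Hf) (gD v)) (IH _ _ (CkW Hg) (fD v)))) => x.
by rewrite deriveM//; apply: diff_derivable.
Qed.

Lemma Cinfty_cst (c : R) : Cinfty (fun _ : V => c).
Proof. by move=> k; exact: Ck_cst. Qed.

Lemma CinftyD f g : Cinfty f -> Cinfty g -> Cinfty (fun x => f x + g x).
Proof. by move=> Hf Hg k; exact: (CkD (Hf k) (Hg k)). Qed.

Lemma CinftyM f g : Cinfty f -> Cinfty g -> Cinfty (fun x => f x * g x).
Proof. by move=> Hf Hg k; exact: (CkM (Hf k) (Hg k)). Qed.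

Lemma CinftyN f : Cinfty f -> Cinfty (fun x => - f x).
Proof.
move=> Hf; under eq_fun do rewrite -mulN1r.
by apply: CinftyM => //; exact: Cinfty_cst.
Qed.

Lemma CinftyX f m : Cinfty f -> Cinfty (fun x => f x ^+ m).
Proof.
move=> Hf; elim: m => [|m IH].
  by under eq_fun do rewrite expr0; exact: Cinfty_cst.
by under eq_fun do rewrite exprS; exact: CinftyM.
Qed.

Lemma Cinfty_sum (I : Type) (s : seq I) (F : I -> V -> R) :
  (forall i, Cinfty (F i)) -> Cinfty (fun x => \sum_(i <- s) F i x).
Proof.
move=> HF; elim: s => [|i s IH].
  by under eq_fun do rewrite big_nil; exact: Cinfty_cst.
by under eq_fun do rewrite big_cons; exact: CinftyD.
Qed.

Lemma Cinfty_linear f : (forall x, differentiable f x) ->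
  (forall v x h, f (x + h *: v) = f x + h * f v) -> Cinfty f.
Proof.
move=> fd fl [|k].
  by move=> x; apply: differentiable_continuous.
split=> // v; apply: (eq_Ck (Ck_cst k (f v))) => x.
have /@derive_val := @is_derive_quadratic _ _ f x v (f v) 0
  (fun h => etrans (fl v x h) (esym (etrans (congr1 _ (mulr0 _)) (addr0 _)))).
by move=> ->.
Qed.

End smooth_functions.

Section test_functions.
Context {R : realType} {n : nat}.

Lemma Cinfty_fst : Cinfty (fun z : R * 'rV[R]_n => z.1).
Proof.
apply: Cinfty_linear => // x.
by apply: linear_differentiable => y; exact: cvg_fst.
Qed.

Lemma Cinfty_coord i : Cinfty (fun z : R * 'rV[R]_n => z.2 0 i).
Proof.
apply: Cinfty_linear => [x|v x h]; last by rewrite !mxE.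
apply: (@differentiable_comp _ _ _ _ snd (fun y : 'rV[R]_n => y 0 i)).
  by apply: linear_differentiable => y; exact: cvg_snd.
exact: differentiable_coord.
Qed.

Lemma Cinfty_sqdist (y : 'rV[R]_n) :
  Cinfty (fun z : R * 'rV[R]_n => dot (z.2 - y) (z.2 - y)).
Proof.
have Hi i : Cinfty (fun z : R * 'rV[R]_n => (z.2 - y) 0 i).
  under eq_fun do rewrite !mxE.
  by apply: CinftyD; [exact: Cinfty_coord|exact: Cinfty_cst].
by apply: Cinfty_sum => i; exact: CinftyM.
Qed.

End test_functions.

(** * Comparison principle *)

Section uniform_continuity.
Context {R : realType}.

Lemma unif_continuousT_continuous {V : normedModType R} (f : V -> R) :
  unif_continuous_on setT f -> continuous f.
Proof.
move=> fuc x; apply/cvgrPdist_lt => e /fuc[d d0 fd].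
by apply/nbhs_normP; exists d => //= y xy; apply: fd.
Qed.

(** Cut the segment from [x] to [y] into equal pieces of length at most [d / 2]: [f] varies by less
    than 1 on each. The point [z] in the induction removes the last of [m.+1] pieces. *)
Lemma unif_continuous_growth {V : normedModType R} (f : V -> R) :
  unif_continuous_on setT f ->
  exists2 C, 0 <= C & forall x y, `|f x - f y| <= C * (1 + `|x - y|).
Proof.
move=> /(_ 1 ltr01)[d d0 fd].
have chain m x y : `|x - y| <= m%:R * (d / 2) -> `|f x - f y| <= m%:R.
  elim: m x y => [|m IH] x y.
    by rewrite mul0r normr_le0 subr_eq0 => /eqP ->; rewrite subrr normr0.
  move=> xy; pose c : R := m%:R / m.+1%:R.
  have m1 : 0 < m.+1%:R :> R by rewrite ltr0n.
  have c0 : 0 <= c by rewrite divr_ge0// ler0n.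
  have cE : 1 - c = m.+1%:R^-1.
    by rewrite /c -[m.+1]addn1 natrD; field; rewrite -[1]/(1%:R) -natrD addn1 gt_eqF.
  pose z := x + c *: (y - x).
  have xz : `|x - z| <= m%:R * (d / 2).
    rewrite /z opprD addrA subrr sub0r normrN normrZ ger0_norm// distrC.
    by apply: (le_trans (ler_wpM2l c0 xy)); rewrite /c -mulrA mulKf ?gt_eqF.
  have zy : `|z - y| < d.
    have -> : z - y = (1 - c) *: (x - y).
      by rewrite scalerBl scale1r -scalerN opprB /z addrAC.
    rewrite normrZ cE ger0_norm ?invr_ge0 ?ltW// mulrC ltr_pdivrMr//.
    apply: (le_lt_trans xy); rewrite mulrC ltr_pM2r//.
    by rewrite ltr_pdivrMr// ltr_pMr// ltr1n.
  have -> : f x - f y = (f x - f z) + (f z - f y) by ring.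
  rewrite (le_trans (ler_normD _ _))// -[m.+1]addn1 natrD lerD//; first exact: IH.
  by rewrite ltW// fd.
exists (2 / d + 1); first by rewrite addr_ge0// divr_ge0// ltW.
move=> x y; pose a := `|x - y| / (d / 2).
have d2 : 0 < d / 2 by rewrite divr_gt0.
have a0 : 0 <= a by rewrite divr_ge0// ltW.
have /andP[aL aU] := truncn_itv a0.
apply: (le_trans (chain (Num.truncn a).+1 _ _ _)).
  by rewrite -ler_pdivrMr// ltW.
rewrite -[_.+1]addn1 natrD mulrDl mul1r mulrDr mulr1.
have -> : 2 / d * `|x - y| = a by rewrite /a; field; rewrite gt_eqF.
have := normr_ge0 (x - y); have : 0 <= 2 / d by rewrite divr_ge0// ltW.
by move=> *; lra.
Qed.

End uniform_continuity.

Section viscosity.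
Context {R : realType} {n : nat}.
Implicit Types (F : 'rV[R]_n -> R) (T t s : R) (x y : 'rV[R]_n)
  (u w phi : R * 'rV[R]_n -> R).

Definition pde F phi t x : R :=
  derive1 (fun t => phi (t, x)) t + F (grad (fun x => phi (t, x)) x).

(** Separated from its dual because comparison asks one inequality of each function only. *)
Definition subsolution F T u := forall phi (t : R) (x : 'rV[R]_n), Cinfty phi -> 0 < t < T ->
  (\forall z \near (t, x), u z - phi z <= u (t, x) - phi (t, x)) ->
  pde F phi t x <= 0.

Definition supersolution F T u := forall phi (t : R) (x : 'rV[R]_n), Cinfty phi -> 0 < t < T ->
  (\forall z \near (t, x), u (t, x) - phi (t, x) <= u z - phi z) ->
  0 <= pde F phi t x.

Lemma viscosity_solutionP F T u : viscosity_solution F T u <->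
  [/\ unif_continuous_on (strip T) u, subsolution F T u & supersolution F T u].
Proof.
split=> [[uc us]|[uc sub sup]].
  by split=> // phi t x Hphi tT; case: (us phi t x Hphi tT).
by split=> // phi t x Hphi tT; split; [exact: sub|exact: sup].
Qed.

Lemma dot_delta (v : 'rV[R]_n) i : dot v (delta_mx 0 i) = v 0 i.
Proof.
rewrite /dot (bigD1 i)//= mxE !eqxx mulr1 big1 ?addr0// => j ji.
by rewrite mxE (negbTE ji) andbF mulr0.
Qed.

(* The shape of both test functions of the doubling argument. *)
Definition quad_test a b (s : R) (y : 'rV[R]_n) g (z : R * 'rV[R]_n) : R :=
  a * dot (z.2 - y) (z.2 - y) + b * dot z.2 z.2 + a * (z.1 - s) ^+ 2 + g z.1.

Lemma pde_quad_test F a b s y (g : R -> R) (dg : R) t x : is_derive t 1 g dg ->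
  pde F (quad_test a b s y g) t x =
  (2 * a) * (t - s) + dg + F ((2 * a) *: (x - y) + (2 * b) *: x).
Proof.
move=> Hg; rewrite /pde derive1E; congr (_ + F _).
  by rewrite /quad_test /=; apply: derive_val; apply: is_derive_eq; rewrite /GRing.scale /=; ring.
apply/rowP => i; rewrite !mxE.
have H := @is_derive_quadratic _ _ (fun x => quad_test a b s y g (t, x)) x
  (delta_mx 0 i) ((2 * a) * (x 0 i - y 0 i) + (2 * b) * x 0 i)
  ((a + b) * dot (delta_mx 0 i) (delta_mx 0 i)).
apply: (@derive_val _ _ _ _ _ _ _ (H _)) => h.
rewrite /quad_test /= addrAC !(dotDl, dotDr, dotZl, dotZr) !(dotC (delta_mx 0 i)).
by rewrite !dot_delta !mxE; ring.
Qed.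

Lemma Cinfty_quad_test a b s y g :
  Cinfty (fun z : R * 'rV[R]_n => g z.1) -> Cinfty (quad_test a b s y g).
Proof.
move=> Hg; have C c : Cinfty (fun _ : R * 'rV[R]_n => c) := @Cinfty_cst _ _ c.
apply: CinftyD => //; apply: CinftyD; first apply: CinftyD.
- by apply: CinftyM => //; exact: Cinfty_sqdist.
- apply: CinftyM => //; have := @Cinfty_sqdist R n 0.
  by under eq_fun do rewrite subr0.
- apply: CinftyM => //; apply: CinftyX.
  by apply: CinftyD => //; exact: Cinfty_fst.
Qed.

Lemma continuous_dot2 {X : topologicalType} (f g : X -> 'rV[R]_n) :
  continuous f -> continuous g -> continuous (fun z => dot (f z) (g z)).
Proof.
move=> fc gc z; apply: cvg_big => [|i _]; first exact: add_continuous.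
apply: cvgM.
  by apply: (cvg_comp f (fun y : 'rV[R]_n => y 0 i) (fc z)); exact: coord_continuous.
by apply: (cvg_comp g (fun y : 'rV[R]_n => y 0 i) (gc z)); exact: coord_continuous.
Qed.

End viscosity.

Section comparison.
Context {R : realType} {n : nat}.
Implicit Types (F : 'rV[R]_n -> R) (t s : R) (x y : 'rV[R]_n)
  (u w : R * 'rV[R]_n -> R).

Section doubling.
Variables (u w : R * 'rV[R]_n -> R) (T : R).
Hypotheses (T_gt0 : 0 < T) (u_uc : unif_continuous_on setT u)
  (w_uc : unif_continuous_on setT w) (uw0 : forall x, u (0, x) <= w (0, x)).

(** Pass through time 0, where [u <= w]: time increments are at most [T], so only the spatial
    distance remains. *)
Lemma doubling_growth : exists2 C, 0 <= C &
  forall t s x y, 0 <= t <= T -> 0 <= s <= T ->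
    u (t, x) - w (s, y) <= C * (1 + `|x - y|).
Proof.
have [Cu Cu0 uC] := unif_continuous_growth u_uc.
have [Cw Cw0 wC] := unif_continuous_growth w_uc.
exists (Cu * (1 + T) + Cw * (1 + T)).
  by rewrite addr_ge0// mulr_ge0// addr_ge0// ltW.
move=> t s x y /andP[t0 tT] /andP[s0 sT].
have := uC (t, x) (0, x); have := wC (0, x) (s, y).
rewrite !prod_normE /= subrr normr0 sub0r subr0 normrN (ger0_norm t0) (ger0_norm s0).
rewrite (max_idPl t0) => wH uH.
have d0 := normr_ge0 (x - y).
have sd : Num.max s `|x - y| <= T + `|x - y|.
  by rewrite ge_max; apply/andP; split; lra.
have Hu : u (t, x) - u (0, x) <= Cu * (1 + T).
  by apply: (le_trans (ler_norm _)); apply: (le_trans uH); rewrite ler_wpM2l// lerD2l.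
have Hw : w (0, x) - w (s, y) <= Cw * (1 + T + `|x - y|).
  by apply: (le_trans (ler_norm _)); apply: (le_trans wH); rewrite ler_wpM2l// -addrA lerD2l.
have := uw0 x; have : 0 <= Cu * (1 + T) * `|x - y| by rewrite !mulr_ge0// addr_ge0// ltW.
have : 0 <= Cw * T * `|x - y| by rewrite !mulr_ge0// ltW.
move: Hu Hw; nra.
Qed.

(** Penalising [x] alone gives compactness, as [A] already controls [x - y]. The barrier is charged
    at both times, to keep each of them away from [T]. *)
Definition doubled A b (r : R -> R) (z : (R * 'rV[R]_n) * (R * 'rV[R]_n)) : R :=
  u z.1 - w z.2 - A * dot (z.1.2 - z.2.2) (z.1.2 - z.2.2)
  - A * (z.1.1 - z.2.1) ^+ 2 - b * dot z.1.2 z.1.2 - r z.1.1 - r z.2.1.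

Lemma continuous_doubled A b r : continuous r -> continuous (doubled A b r).
Proof.
pose Z := ((R * 'rV[R]_n) * (R * 'rV[R]_n))%type.
have c1 : continuous (fun z : Z => z.1) by move=> z; exact: cvg_fst.
have c2 : continuous (fun z : Z => z.2) by move=> z; exact: cvg_snd.
have c11 : continuous (fun z : Z => z.1.1).
  by move=> z; apply: (cvg_comp (fun z : Z => z.1) fst (c1 z)); exact: cvg_fst.
have c12 : continuous (fun z : Z => z.1.2).
  by move=> z; apply: (cvg_comp (fun z : Z => z.1) snd (c1 z)); exact: cvg_snd.
have c21 : continuous (fun z : Z => z.2.1).
  by move=> z; apply: (cvg_comp (fun z : Z => z.2) fst (c2 z)); exact: cvg_fst.
have c22 : continuous (fun z : Z => z.2.2).
  by move=> z; apply: (cvg_comp (fun z : Z => z.2) snd (c2 z)); exact: cvg_snd.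
have ucont := unif_continuousT_continuous u_uc.
have wcont := unif_continuousT_continuous w_uc.
have dc : continuous (fun z : Z => z.1.2 - z.2.2).
  by move=> z; apply: cvgB; [exact: c12|exact: c22].
move=> rc z; rewrite /doubled.
apply: cvgB; [apply: cvgB|]; [apply: cvgB| |]; [apply: cvgB| | |];
  [apply: cvgB| | | |]; [apply: cvgB| | | | |].
- by apply: (cvg_comp (fun z : Z => z.1) u (c1 z)); exact: ucont.
- by apply: (cvg_comp (fun z : Z => z.2) w (c2 z)); exact: wcont.
- by apply: cvgM; [exact: cvg_cst|exact: (continuous_dot2 dc dc)].
- apply: cvgM; [exact: cvg_cst|].
  apply: (cvg_comp (fun z : Z => z.1.1 - z.2.1) (fun x : R => x ^+ 2)); last first.
    exact: exprn_continuous.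
  by apply: cvgB; [exact: c11|exact: c21].
- by apply: cvgM; [exact: cvg_cst|exact: (continuous_dot2 c12 c12)].
- by apply: (cvg_comp (fun z : Z => z.1.1) r (c11 z)); exact: rc.
- by apply: (cvg_comp (fun z : Z => z.2.1) r (c21 z)); exact: rc.
Qed.

(* The doubled function is nonpositive outside of a compact set, so a positive value makes its
   maximum over times in [0, T] attained. *)
Lemma doubled_max A b r C : continuous r -> 0 < A -> 0 < b ->
  (forall t s x y, 0 <= t <= T -> 0 <= s <= T ->
     doubled A b r ((t, x), (s, y)) <= C - A / 2 * `|x - y| ^+ 2 - b * `|x| ^+ 2) ->
  (exists t x, 0 <= t <= T /\ 0 < doubled A b r ((t, x), (t, x))) ->
  exists t0 x0 s0 y0, [/\ 0 <= t0 <= T, 0 <= s0 <= T &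
    forall t x s y, 0 <= t <= T -> 0 <= s <= T ->
      doubled A b r ((t, x), (s, y)) <= doubled A b r ((t0, x0), (s0, y0))].
Proof.
move=> rc A0 b0 HC [t1 [x1 [t1T D1]]].
(* Radii for [x] and [x - y] where the function is positive; [a <= a ^+ 2 + 1] turns bounds on
   squares into bounds without square roots. *)
pose r0 := C / b + 1; pose r1 := C / (A / 2) + 1.
have A20 : 0 < A / 2 by rewrite divr_gt0.
have sqb (c a : R) : 0 < c -> 0 <= a -> c * a ^+ 2 <= C -> a <= C / c + 1.
  move=> c0 a0 H; have : a ^+ 2 <= C / c by rewrite ler_pdivlMr// mulrC.
  by have := sqr_ge0 (a - 1); nra.
have bnd t s x y : 0 <= t <= T -> 0 <= s <= T ->
    0 < doubled A b r ((t, x), (s, y)) -> `|x| <= r0 + r1 /\ `|y| <= r0 + r1.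
  move=> tT sT /lt_le_trans/(_ (HC t s x y tT sT)) H.
  have H1 : 0 <= A / 2 * `|x - y| ^+ 2 by rewrite mulr_ge0 ?sqr_ge0// ltW.
  have H2 : 0 <= b * `|x| ^+ 2 by rewrite mulr_ge0 ?sqr_ge0// ltW.
  have xr : `|x| <= r0 by apply: sqb => //; lra.
  have xyr : `|x - y| <= r1 by apply: sqb => //; lra.
  split; first by have := normr_ge0 (x - y); lra.
  have -> : y = x - (x - y) by rewrite opprB addrC subrK.
  by apply: (le_trans (ler_normB _ _)); rewrite lerD.
pose B : set (R * 'rV[R]_n) := `[0, T] `*` [set x | `|x| <= r0 + r1].
have Bcpt : compact B.
  by apply: compact_setX; [exact: segment_compact|exact: compact_norm_le].
have [|||z zB zmax] := @compact_EVT_max _ _ (doubled A b r) (B `*` B).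
- have [] := bnd _ _ _ _ t1T t1T D1.
  by exists ((t1, x1), (t1, x1)); split; split; rewrite //= in_itv.
- exact: compact_setX.
- by apply: continuous_subspaceT; exact: continuous_doubled.
move: zB zmax; rewrite inE; case: z => [[t0 x0] [s0 y0]] [[/= + _] [/= + _]] zmax.
rewrite !in_itv /= => t0T s0T.
have inB t x s y : 0 <= t <= T -> 0 <= s <= T -> `|x| <= r0 + r1 -> `|y| <= r0 + r1 ->
    doubled A b r ((t, x), (s, y)) <= doubled A b r ((t0, x0), (s0, y0)).
  by move=> *; apply: zmax; rewrite inE; split; split; rewrite //= in_itv.
exists t0, x0, s0, y0; split=> // t x s y tT sT.
have [D0|D0] := ltP 0 (doubled A b r ((t, x), (s, y))).
  by have [] := bnd _ _ _ _ tT sT D0; exact: inB.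
have [x1r x1r'] := bnd _ _ _ _ t1T t1T D1.
by apply: (le_trans D0); apply: (le_trans (ltW D1)); exact: inB.
Qed.

End doubling.
End comparison.

Section comparison_principle.
Context {R : realType} {n : nat}.
Implicit Types (F : 'rV[R]_n -> R) (t s : R) (x y : 'rV[R]_n)
  (u w : R * 'rV[R]_n -> R).

Lemma near_strip (T t : R) x : 0 < t < T ->
  \forall z \near (t, x), 0 <= z.1 <= T.
Proof.
move=> /andP[t0 tT]; apply/nbhs_normP; exists (Num.min t (T - t)).
  by rewrite /= lt_min t0 subr_gt0.
move=> [s y] /=; rewrite prod_normE /= gt_max => /andP[+ _].
by rewrite lt_min !ltr_norml => /andP[/andP[? ?] /andP[? ?]]; apply/andP; split; lra.
Qed.

(* The barrier r is small at time t and large at time T; added to the test functions, it keeps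
   maximum points away from the final time. *)
Lemma barrier (T t c M : R) : 0 < t < T -> 0 < c -> 0 < M ->
  exists (r dr : R -> R) (e : R),
  [/\ Cinfty (fun z : R * 'rV[R]_n => r z.1),
      forall s, is_derive s 1 r (dr s),
      0 < e,
      forall s, 0 <= s -> 0 <= r s /\ e <= dr s &
      r t <= c /\ M <= r T].
Proof.
move=> /andP[t0 tT] c0 M0.
have T0 : 0 < T by exact: lt_trans tT.
have tT1 : `|t / T| < 1.
  by rewrite ger0_norm ?divr_ge0 ?ltW// ltr_pdivrMr// mul1r.
have cM : 0 < c / 2 / M by rewrite !divr_gt0.
(* A barrier blowing up at [T] would not be smooth on the whole space. A steep power [s ^+ N]
   replaces it: [(t / T) ^+ N] is small for large [N], while the value at [T] is normalised to [M].
   The linear term keeps the derivative at least [e]. *)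
have /cvgrPdist_lt/(_ _ cM)[N _ /(_ N (leqnn N))/=] := cvg_expr tT1.
rewrite sub0r normrN ger0_norm ?exprn_ge0 ?divr_ge0 ?ltW// => HN.
pose e := c / 2 / T; pose K := M / T ^+ N.
have e0 : 0 < e by rewrite !divr_gt0.
have K0 : 0 < K by rewrite divr_gt0// exprn_gt0.
exists (fun s => e * s + K * s ^+ N), (fun s => e + K * (N%:R * s ^+ N.-1)), e; split.
- apply: CinftyD; apply: CinftyM; [exact: Cinfty_cst|exact: Cinfty_fst|exact: Cinfty_cst|].
  by apply: CinftyX; exact: Cinfty_fst.
- move=> s; have HN' : is_derive s 1 (fun x : R => x ^+ N) (N%:R * s ^+ N.-1).
    apply: DeriveDef; first exact: exprn_derivable.
    by rewrite exp_derive; rewrite /GRing.scale /= mulr1.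
  have := is_deriveD (is_deriveZ e (is_derive_id s 1)) (is_deriveZ K HN').
  by rewrite /GRing.scale /= mulr1.
- exact: e0.
- move=> s s0; split.
    by rewrite addr_ge0// mulr_ge0 ?exprn_ge0// ltW.
  by rewrite lerDl (mulr_ge0 (ltW K0))// mulr_ge0 ?exprn_ge0.
- split.
    have -> : K * t ^+ N = M * (t / T) ^+ N by rewrite /K expr_div_n; ring.
    rewrite (splitr c) lerD//.
      have : e * t <= e * T by rewrite ler_wpM2l// ltW.
      by rewrite /e divfK ?gt_eqF.
    by rewrite ltW// mulrC -ltr_pdivlMr.
  have -> : K * T ^+ N = M by rewrite divfK// gt_eqF// exprn_gt0.
  by rewrite lerDr mulr_ge0// ltW.
Qed.

Lemma comparison_interior F u w T : continuous F ->
  unif_continuous_on setT u -> unif_continuous_on setT w ->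
  subsolution F T u -> supersolution F T w ->
  (forall x, u (0, x) <= w (0, x)) ->
  forall t x, 0 < t < T -> u (t, x) <= w (t, x).
Proof.
move=> Fc u_uc w_uc usub wsup uw0 t1 x1 t1T; rewrite leNgt; apply/negP => uw1.
have T0 : 0 < T by case/andP: t1T; exact: lt_trans.
(* A quarter of the excess: the penalty on [x1] and the two barrier terms cost at most [c] each,
   which leaves [c] in [D1]. *)
pose c := (u (t1, x1) - w (t1, x1)) / 4.
have c0 : 0 < c by rewrite divr_gt0// subr_gt0.
have [C1 C10 HC1] := doubling_growth T0 u_uc w_uc uw0.
(* Young's inequality: [C1 * D <= C1 ^+ 2 / 2 + D ^+ 2 / 2], and [1 <= A] lets half of the penalty
   absorb the square. *)
pose C := C1 + C1 ^+ 2 / 2.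
have C0 : 0 <= C by rewrite addr_ge0// divr_ge0// sqr_ge0.
have C01 : 0 < C + 1 by rewrite ltr_wpDl.
have [r [dr [e [rsm dr_r e0 r0 [rt1 rT]]]]] := barrier t1T c0 C01.
have [du du0 Hdu] := u_uc _ c0.
have [dw dw0 Hdw] := w_uc _ c0.
pose d := Num.min du dw.
have d0 : 0 < d by rewrite lt_min du0.
(* Chosen so that [A / 2 * d ^+ 2] exceeds [C], which forces the two maximum points to lie within
   [d] of each other. *)
pose A := 1 + 2 * (C + 1) / d ^+ 2.
have A1 : 1 <= A by rewrite lerDl divr_ge0 ?sqr_ge0// mulr_ge0// ltW.
have A0 : 0 < A by exact: lt_le_trans A1.
have Ad a : 0 <= a -> A / 2 * a ^+ 2 <= C -> a < d.
  move=> a0 aC; rewrite ltNge; apply/negP => da.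
  have : A / 2 * d ^+ 2 <= C.
    by apply: le_trans aC; rewrite ler_wpM2l ?(divr_ge0 (ltW A0))// ler_pXn2r ?nnegrE// ltW.
  rewrite /A mulrDl mul1r mulrDl.
  have -> : 2 * (C + 1) / d ^+ 2 / 2 * d ^+ 2 = C + 1 by field; rewrite gt_eqF.
  by have : 0 <= 2^-1 * d ^+ 2 by [rewrite mulr_ge0// sqr_ge0]; lra.
have e20 : 0 < 2 * e by rewrite mulr_gt0.
(* The ball contains [2 * A * (x0 - y0)] whatever [b] is, so [b] may be chosen after [dF], small
   enough that the extra gradient [2 * b * x0] stays below it. *)
have [dF dF0 HdF] := unif_continuous_ball (2 * A * d) Fc e20.
pose b := Num.min (c / (1 + dot x1 x1)) (dF ^+ 2 / (8 * (C + 1))).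
have x10 : 0 < 1 + dot x1 x1 by rewrite ltr_wpDr// dot_ge0.
have b0 : 0 < b.
  by rewrite lt_min (divr_gt0 c0 x10) divr_gt0// ?exprn_gt0// mulr_gt0.
have bx1 : b * dot x1 x1 <= c.
  apply: (@le_trans _ _ (c / (1 + dot x1 x1) * dot x1 x1)).
    by rewrite ler_wpM2r ?dot_ge0// ge_min lexx.
  by rewrite mulrAC ler_pdivrMr// ler_wpM2l ?(ltW c0)// lerDr.
have bdF : b * (8 * (C + 1)) <= dF ^+ 2.
  by rewrite -ler_pdivlMr ?mulr_gt0// ge_min lexx orbT.
have bound t s x y : 0 <= t <= T -> 0 <= s <= T ->
    doubled u w A b r ((t, x), (s, y)) <=
    C - A / 2 * `|x - y| ^+ 2 - A * (t - s) ^+ 2 - b * `|x| ^+ 2 - r t - r s.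
  move=> tT sT; rewrite /doubled /=.
  have := HC1 _ _ x y tT sT.
  have : A * `|x - y| ^+ 2 <= A * dot (x - y) (x - y) by rewrite ler_wpM2l ?norm_le_dot// ltW.
  have : b * `|x| ^+ 2 <= b * dot x x by rewrite ler_wpM2l ?norm_le_dot// ltW.
  have := sqr_ge0 (C1 - `|x - y|); have := sqr_ge0 `|x - y|.
  rewrite /C; move: A1 C10 (normr_ge0 (x - y)).
  set D := `|x - y|; nra.
have rc : continuous r.
  move=> s; apply: differentiable_continuous; apply/derivable1_diffP.
  exact: ex_derive.
have D1 : c <= doubled u w A b r ((t1, x1), (t1, x1)).
  rewrite /doubled /= !subrr dot0l expr0n/= !mulr0 !subr0.
  have : u (t1, x1) - w (t1, x1) = 4 * c by rewrite /c; field.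
  by lra.
have t1cc : 0 <= t1 <= T by case/andP: t1T => *; rewrite !ltW.
have [|t0 [x0 [s0 [y0 [t0T s0T zmax]]]]] :=
    doubled_max u_uc w_uc rc A0 b0 (C := C) _
      (ex_intro _ t1 (ex_intro _ x1 (conj t1cc (lt_le_trans c0 D1)))).
  move=> t s x y tT sT; apply: (le_trans (bound _ _ _ _ tT sT)).
  have /andP[/r0[rt _] _] := tT; have /andP[/r0[rs _] _] := sT.
  by have : 0 <= A * (t - s) ^+ 2 by [rewrite mulr_ge0 ?sqr_ge0// ltW]; lra.
have D0 := le_trans D1 (zmax _ _ _ _ t1cc t1cc).
have B0 := le_trans D0 (bound _ _ _ _ t0T s0T).
have /andP[t00 t0leT] := t0T; have /andP[s00 s0leT] := s0T.
have [[rt0 ert0] [rs0 ers0]] := (r0 _ t00, r0 _ s00).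
have P1 : 0 <= A / 2 * `|x0 - y0| ^+ 2 by rewrite mulr_ge0 ?sqr_ge0// divr_ge0// ltW.
have P2 : 0 <= A * (t0 - s0) ^+ 2 by rewrite mulr_ge0 ?sqr_ge0// ltW.
have P3 : 0 <= b * `|x0| ^+ 2 by rewrite mulr_ge0 ?sqr_ge0// ltW.
have xyd : `|x0 - y0| < d by apply: Ad => //; move: P2 P3 rt0 rs0 B0 c0; clear; lra.
have tsd : `|t0 - s0| < d.
  apply: Ad => //; rewrite real_normK ?num_real//.
  have -> : A / 2 * (t0 - s0) ^+ 2 = A * (t0 - s0) ^+ 2 / 2 by ring.
  by move: P1 P2 P3 rt0 rs0 B0 c0; clear; lra.
have [xydu xydw] : `|x0 - y0| < du /\ `|x0 - y0| < dw by apply/andP; rewrite -lt_min.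
have [tsdu tsdw] : `|t0 - s0| < du /\ `|t0 - s0| < dw by apply/andP; rewrite -lt_min.
have rneq s : 0 <= s <= T -> r s <= C -> s < T.
  move=> /andP[_]; rewrite le_eqVlt => /orP[/eqP ->|//]; by move: rT; clear; lra.
have t0ltT : t0 < T by apply: rneq => //; move: P1 P2 P3 rt0 rs0 B0 c0; clear; lra.
have s0ltT : s0 < T by apply: rneq => //; move: P1 P2 P3 rt0 rs0 B0 c0; clear; lra.
have Dle : doubled u w A b r ((t0, x0), (s0, y0)) <= u (t0, x0) - w (s0, y0).
  have Q1 : 0 <= A * dot (x0 - y0) (x0 - y0) by rewrite mulr_ge0 ?dot_ge0// ltW.
  have Q2 : 0 <= b * dot x0 x0 by rewrite mulr_ge0 ?dot_ge0// ltW.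
  by move: Q1 Q2 P2 rt0 rs0; rewrite /doubled /=; clear; lra.
have cle := le_trans D0 Dle.
(* At [t0 = 0] the order of the initial data would give [c <= w (0, x0) - w (s0, y0)], while [w]
   varies by less than [c] at distance [d]. The case [s0 = 0] is symmetric, with [u]. *)
have t0gt0 : 0 < t0.
  rewrite lt_def t00 andbT; apply/eqP => t0E.
  have := Hdw (t0, x0) (s0, y0) I I; rewrite prod_normE /= gt_max tsdw xydw.
  move=> /(_ isT); rewrite ltr_norml => /andP[_].
  by move: cle; rewrite t0E; move: (uw0 x0); clear; lra.
have s0gt0 : 0 < s0.
  rewrite lt_def s00 andbT; apply/eqP => s0E.
  have := Hdu (t0, x0) (s0, y0) I I; rewrite prod_normE /= gt_max tsdu xydu.
  move=> /(_ isT); rewrite ltr_norml => /andP[_].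
  by move: cle; rewrite s0E; move: (uw0 y0); clear; lra.
have t0oo : 0 < t0 < T by rewrite t0gt0.
have s0oo : 0 < s0 < T by rewrite s0gt0.
have usub0 : 2 * A * (t0 - s0) + dr t0 + F ((2 * A) *: (x0 - y0) + (2 * b) *: x0) <= 0.
  rewrite -(pde_quad_test F A b s0 y0 x0 (dr_r t0)); apply: usub => //.
    exact: Cinfty_quad_test.
  apply: filterS (near_strip x0 t0oo) => -[t x] /= tT.
  move: (zmax _ x _ y0 tT s0T).
  by rewrite /doubled /quad_test /=; clear; lra.
(* With [(t0, x0)] frozen, maximality means that [w] is touched from below, by a test function with
   the opposite signs of [A] and [r]. *)
have wsup0 : 0 <= 2 * (- A) * (s0 - t0) - dr s0 + F ((2 * - A) *: (y0 - x0) + (2 * 0) *: y0).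
  have drN := is_deriveN (dr_r s0).
  rewrite -(pde_quad_test F (- A) 0 t0 x0 y0 drN); apply: wsup => //.
    by apply: Cinfty_quad_test; exact: CinftyN.
  apply: filterS (near_strip y0 s0oo) => -[s y] /= sT.
  move: (zmax _ x0 _ y t0T sT).
  rewrite /doubled /quad_test /= -(opprB y x0) -(opprB y0 x0) !(dotNl, dotNr) !opprK.
  by rewrite -(sqrrN (t0 - s)) -(sqrrN (t0 - s0)) !opprB; clear; lra.
(* The time slopes cancel on subtracting: [dr t0 + dr s0 <= F p - F (p + q) < 2 * e], against
   [e <= dr] at both times. *)
pose p := (2 * A) *: (x0 - y0); pose q := (2 * b) *: x0.
have pqp : p + q - p = q by rewrite addrC addKr.
have := HdF p (p + q).
have [A20 b20] : 0 <= 2 * A /\ 0 <= 2 * b by rewrite !mulr_ge0// ltW.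
have -> : `|p| = 2 * A * `|x0 - y0| by rewrite normrZ (ger0_norm A20).
have -> : `|p + q - p| = 2 * b * `|x0| by rewrite pqp normrZ (ger0_norm b20).
have small : 2 * b * `|x0| < dF.
  rewrite -(@ltr_pXn2r _ 2)// ?nnegrE ?mulr_ge0// ?ltW//.
  have -> : (2 * b * `|x0|) ^+ 2 = 4 * b * (b * `|x0| ^+ 2) by ring.
  have : b * `|x0| ^+ 2 <= C by move: P1 P2 rt0 rs0 B0 c0; clear; lra.
  have : 0 < dF ^+ 2 by rewrite exprn_gt0.
  by move: bdF b0 C0 P3; clear; nra.
have Pd : 2 * A * `|x0 - y0| <= 2 * A * d by rewrite ler_wpM2l ?mulr_ge0// ltW.
move=> /(_ Pd small); rewrite ltr_norml => /andP[H1 _].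
move: wsup0; rewrite mulr0 scale0r addr0 mulrN scaleNr -scalerN opprB.
have -> : - (2 * A) * (s0 - t0) = 2 * A * (t0 - s0) by ring.
rewrite -/p in usub0 *; rewrite -/q in usub0.
by move: usub0 H1 ert0 ers0 e0; clear; lra.
Qed.

End comparison_principle.

Section uniqueness.
Context {R : realType} {n : nat}.
Implicit Types (F : 'rV[R]_n -> R) (T t s : R) (x y : 'rV[R]_n)
  (u w : R * 'rV[R]_n -> R).

Definition clamp T t : R := Num.max 0 (Num.min t T).

(* Viscosity solutions are only controlled on the strip; freezing them outside [0, T] makes them
   uniformly continuous on the whole space. *)
Definition time_extension T u z := u (clamp T z.1, z.2).

Lemma clamp_id T t : 0 <= t <= T -> clamp T t = t.
Proof. by case/andP => t0 tT; rewrite /clamp min_l// max_r. Qed.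

Lemma clamp_itv T t : 0 < T -> 0 <= clamp T t <= T.
Proof.
by move=> T0; rewrite /clamp le_max lexx ge_max (ltW T0) ge_min lexx orbT.
Qed.

Lemma clamp_dist T t s : `|clamp T t - clamp T s| <= `|t - s|.
Proof.
have dist (a b c : R) : - c <= a - b <= c -> `|a - b| <= c by rewrite ler_norml.
have undist (a b : R) : - `|a - b| <= a - b <= `|a - b| by rewrite -ler_norml.
have maxd (a b : R) : `|Num.max 0 a - Num.max 0 b| <= `|a - b|.
  have /andP[h1 h2] := undist a b; have d0 := normr_ge0 (a - b); apply: dist.
  by case: (leP 0 a) => ?; case: (leP 0 b) => ?; apply/andP; split; lra.
have mind (a b : R) : `|Num.min a T - Num.min b T| <= `|a - b|.
  have /andP[h1 h2] := undist a b; have d0 := normr_ge0 (a - b); apply: dist.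
  by case: (leP a T) => ?; case: (leP b T) => ?; apply/andP; split; lra.
exact: le_trans (maxd _ _) (mind _ _).
Qed.

Lemma time_extension_uc T u : 0 < T -> unif_continuous_on (strip T) u ->
  unif_continuous_on setT (time_extension T u).
Proof.
move=> T0 uc e /uc[d d0 ud]; exists d => // z z' _ _ zz'.
apply: ud; rewrite /strip /= ?clamp_itv//; apply: le_lt_trans zz'.
by rewrite !prod_normE /= ge_max !le_max clamp_dist lexx orbT.
Qed.

Lemma time_extension_sub F T u : subsolution F T u -> subsolution F T (time_extension T u).
Proof.
move=> usub phi t x Hphi tT umax; apply: usub => //.
have tT' : 0 <= t <= T by case/andP: tT => *; rewrite !ltW.
apply: filterS2 (near_strip x tT) umax => -[s y] /= sT.
by rewrite /time_extension /= !clamp_id.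
Qed.

Lemma time_extension_super F T u :
  supersolution F T u -> supersolution F T (time_extension T u).
Proof.
move=> usup phi t x Hphi tT umax; apply: usup => //.
have tT' : 0 <= t <= T by case/andP: tT => *; rewrite !ltW.
apply: filterS2 (near_strip x tT) umax => -[s y] /= sT.
by rewrite /time_extension /= !clamp_id.
Qed.

Lemma comparison F T u w : 0 < T -> continuous F ->
  unif_continuous_on (strip T) u -> unif_continuous_on (strip T) w ->
  subsolution F T u -> supersolution F T w ->
  (forall x, u (0, x) <= w (0, x)) ->
  forall t x, 0 <= t <= T -> u (t, x) <= w (t, x).
Proof.
move=> T0 Fc u_uc w_uc usub wsup uw0.
have interior t x : 0 < t < T -> u (t, x) <= w (t, x).
  move=> tT; have tT' : 0 <= t <= T by case/andP: tT => *; rewrite !ltW.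
  have ext0 y : time_extension T u (0, y) <= time_extension T w (0, y).
    by rewrite /time_extension /= clamp_id// lexx ltW.
  have := comparison_interior Fc (time_extension_uc T0 u_uc) (time_extension_uc T0 w_uc)
    (time_extension_sub usub) (time_extension_super wsup) ext0 x tT.
  by rewrite /time_extension /= clamp_id.
move=> t x /andP[]; rewrite le_eqVlt => /orP[/eqP <- _|t0]; first exact: uw0.
rewrite le_eqVlt => /orP[/eqP ->|tT]; last by apply: interior; rewrite t0.
(* The final time is reached from [T - d] by uniform continuity, each function contributing at most
   [e / 2]. *)
apply/ler_addgt0Pr => e e0; have e20 : 0 < e / 2 by rewrite divr_gt0.
have [du du0 Hu] := u_uc _ e20; have [dw dw0 Hw] := w_uc _ e20.
pose d := Num.min (T / 2) (Num.min (du / 2) (dw / 2)).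
have d0 : 0 < d by rewrite !lt_min !divr_gt0.
have dT : d <= T / 2 by rewrite ge_min lexx.
have ddu : d < du by apply: (@le_lt_trans _ _ (du / 2)); [rewrite !ge_min lexx orbT|lra].
have ddw : d < dw by apply: (@le_lt_trans _ _ (dw / 2)); [rewrite !ge_min lexx !orbT|lra].
have zz' : `|(T, x) - (T - d, x)| = d.
  by rewrite prod_normE /= subrr normr0 subKr (gtr0_norm d0) max_l// ltW.
have sT : strip T (T, x) by rewrite /strip /= lexx ltW.
have sTd : strip T (T - d, x) by rewrite /strip /=; apply/andP; split; lra.
have iTd : 0 < T - d < T by apply/andP; split; lra.
have := Hu _ _ sT sTd; have := Hw _ _ sT sTd; have := interior _ x iTd.
rewrite zz' !ltr_norml => uwd /(_ ddw)/andP[+ _] /(_ ddu)/andP[_ +].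
by move: uwd; clear; lra.
Qed.

Lemma viscosity_unique F T u w : 0 < T -> continuous F ->
  viscosity_solution F T u -> viscosity_solution F T w ->
  (forall x, u (0, x) = w (0, x)) ->
  forall t x, 0 <= t <= T -> u (t, x) = w (t, x).
Proof.
move=> T0 Fc /viscosity_solutionP[u1 u2 u3] /viscosity_solutionP[w1 w2 w3] uw t x tT.
by apply: le_anti; rewrite (comparison T0 Fc u1 w1)// ?(comparison T0 Fc w1 u1)// => y; rewrite uw.
Qed.

End uniqueness.

(** * Convex conjugation *)

Section extrema.
Context {R : realType} {T : Type} (f : T -> R).

Lemma sup_max p : (forall p', f p' <= f p) -> sup (range f) = f p.
Proof.
move=> fp; apply: le_anti; rewrite ge_sup/=; [|by exists (f p), p|by move=> _ [p' _ <-]].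
by apply: ub_le_sup; [exists (f p) => _ [p' _ <-]|exists p].
Qed.

Lemma inf_min p : (forall p', f p <= f p') -> inf (range f) = f p.
Proof.
move=> fp; apply: le_anti; rewrite lb_le_inf/=; [|by exists (f p), p|by move=> _ [p' _ <-]].
by rewrite andbT; apply: ge_inf; [exists (f p) => _ [p' _ <-]|exists p].
Qed.

End extrema.

Section hamiltonian.
Context {R : realType} {n : nat}.
Implicit Types (H : 'rV[R]_n -> R) (p q h : 'rV[R]_n).

(** The slopes are an arbitrary field [DH], so that the reflected Hamiltonian inherits the property
    without being differentiated. *)
Definition strictly_convex H (DH : 'rV[R]_n -> 'rV[R]_n) :=
  forall p p', p' != p -> H p + dot (DH p) (p' - p) < H p'.

(** Superlinearity without the quotient, which is meaningless at 0, and in the library norm. *)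
Definition supergrowth H := forall A, exists C, forall p, A * `|p| - C <= H p.

Lemma superlinear_growth H : continuous H -> superlinear H -> supergrowth H.
Proof.
move=> Hc Hs A; have [M HM] := Hs (Num.max A 0).
have [|||p0 _ Hp0] := @compact_EVT_min _ _ H [set p | `|p| <= Num.max M 0].
- by exists 0; rewrite /= normr0 le_max lexx orbT.
- exact: compact_norm_le.
- exact: continuous_subspaceT.
pose C := Num.max 0 (Num.max A 0 * Num.max M 0 - H p0).
have A0 : 0 <= Num.max A 0 by rewrite le_max lexx orbT.
exists C => p; apply: (@le_trans _ _ (Num.max A 0 * `|p| - C)).
  by rewrite lerD2r ler_wpM2r// le_max lexx.
have [pM|pM] := leP `|p| (Num.max M 0).
  have : H p0 <= H p by apply: Hp0; rewrite inE.
  have : Num.max A 0 * Num.max M 0 - H p0 <= C by rewrite le_max lexx orbT.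
  have : Num.max A 0 * `|p| <= Num.max A 0 * Num.max M 0 by rewrite ler_wpM2l.
  by clear; lra.
have e0 : 0 < enorm p.
  by apply: (le_lt_trans _ (lt_le_trans pM (norm_le_enorm p))); rewrite le_max lexx orbT.
have : Num.max A 0 * enorm p <= H p.
  rewrite -ler_pdivlMr// ltW//; apply: HM; apply: lt_le_trans (norm_le_enorm p).
  by apply: le_lt_trans pM; rewrite le_max lexx.
have : Num.max A 0 * `|p| <= Num.max A 0 * enorm p.
  by rewrite ler_wpM2l// norm_le_enorm.
have : 0 <= C by rewrite le_max lexx.
by clear; lra.
Qed.

Lemma hessian_derive H p v : Ck 2 H ->
  'D_v (fun y => 'D_v H y) p = (v *m hessian H p *m v^T) 0 0.
Proof.
move=> [Hd HD]; have HDd w y : differentiable (fun x => 'D_w H x) y by case: (HD w).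
have -> : (fun y => 'D_v H y) = \sum_i (fun y => v 0 i *: 'D_(delta_mx 0 i) H y).
  apply/funext => y; rewrite deriv_dot// fct_sumE; apply: eq_bigr => i _.
  by rewrite mxE mulrC.
rewrite derive_sum; last by move=> i; apply: derivableZ; exact: diff_derivable.
rewrite -mulmxA mxE; apply: eq_bigr => i _.
rewrite deriveZ; last exact: diff_derivable.
rewrite /GRing.scale /=; congr (_ * _); rewrite deriv_dot// mxE; apply: eq_bigr => j _.
by rewrite !mxE.
Qed.

(** The mean value theorem is applied twice along the segment: to [H], then to its directional
    derivative between 0 and the intermediate point, where the Hessian supplies the sign. *)
Lemma Ck2_strictly_convex H : Ck 2 H -> (forall p, posdefmx (hessian H p)) ->
  strictly_convex H (grad H).
Proof.
move=> H2 Hpos p p' pp'; have [Hd HD] := H2.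
have HDd w y : differentiable (fun x => 'D_w H x) y by case: (HD w).
pose v := p' - p; have v0 : v != 0 by rewrite subr_eq0.
pose line (s : R) := p + s *: v.
have is_line (f : 'rV[R]_n -> R) s : differentiable f (line s) ->
    is_derive s 1 (f \o line) ('D_v f (line s)).
  move=> fd.
  have E : (fun h : R => h^-1 *: ((f \o line) (h *: (1 : R) + s) - (f \o line) s)) =
           (fun h : R => h^-1 *: (f (h *: v + line s) - f (line s))).
    by apply/funext => h /=; rewrite /line scalerDl addrCA [_ *: 1]mulr1.
  have fv : derivable f (line s) v by exact: diff_derivable.
  by apply: DeriveDef; rewrite /derivable /derive /= E.
have cont (f : 'rV[R]_n -> R) a b : (forall s, differentiable f (line s)) ->
    {within `[a, b], continuous (f \o line)}.
  move=> fd; apply: continuous_subspaceT => s.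
  apply: differentiable_continuous; apply/derivable1_diffP.
  exact: (@ex_derive _ _ _ _ _ _ _ (is_line f s (fd s))).
have [c] := @MVT _ _ _ 0 1 ltr01 (fun s _ => is_line H s (Hd _)) (cont _ 0 1 (fun s => Hd _)).
rewrite in_itv /= => /andP[c0 c1]; rewrite subr0 mulr1 /line /=.
have pv : p + v = p' by rewrite /v addrC subrK.
rewrite scale1r scale0r addr0 pv => HE.
have [c' _] := @MVT _ _ _ 0 c c0 (fun s _ => is_line _ s (HDd v _)) (cont _ 0 c (fun s => HDd v _)).
rewrite /= /line scale0r addr0 subr0 => DE.
have : 0 < 'D_v (fun x => 'D_v H x) (p + c' *: v) * c.
  by rewrite mulr_gt0// hessian_derive//; exact: Hpos.
by rewrite -DE -deriv_dot// -/v; move: HE; rewrite -/v; clear; lra.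
Qed.

End hamiltonian.

Section legendre.
Context {R : realType} {n : nat}.
Variables (H : 'rV[R]_n -> R) (DH : 'rV[R]_n -> 'rV[R]_n).
Hypotheses (H_cont : continuous H) (H_conv : strictly_convex H DH) (H_growth : supergrowth H).
Implicit Types (p q h : 'rV[R]_n).

Definition legendre q : R := sup (range (fun p => dot q p - H p)).

Lemma strictly_convex_ineq p p' s : p' != p -> 0 < s < 1 ->
  H (p + s *: (p' - p)) < (1 - s) * H p + s * H p'.
Proof.
move=> pp' /andP[s0 s1]; have v0 : p' - p != 0 by rewrite subr_eq0.
set m := p + s *: (p' - p).
have mp : p - m = - s *: (p' - p) by rewrite /m opprD addrA subrr sub0r scaleNr.
have mp' : p' - m = (1 - s) *: (p' - p) by rewrite /m opprD addrA scalerBl scale1r.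
have /H_conv : p != m.
  by rewrite -subr_eq0 mp scaler_eq0 negb_or v0 oppr_eq0 gt_eqF.
have /H_conv : p' != m.
  by rewrite -subr_eq0 mp' scaler_eq0 negb_or v0 subr_eq0 gt_eqF.
rewrite mp mp' !dotZr; set D := dot _ _ => h1 h2.
have : (1 - s) * (H m + - s * D) < (1 - s) * H p by rewrite ltr_pM2l// subr_gt0.
have : s * (H m + (1 - s) * D) < s * H p' by rewrite ltr_pM2l.
by clear; nra.
Qed.

Lemma legendre_max q : exists p, forall p', dot q p' - H p' <= dot q p - H p.
Proof.
(* The factor [n%:R] is the Cauchy-Schwarz constant for the sup norm; the extra 1 gives
   coercivity. *)
have [C HC] := H_growth (n%:R * `|q| + 1).
have [||p Hp] := @coercive_min _ _ (fun p => H p - dot q p) (C + H 0).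
- move=> p; apply: cvgB; [exact: nbhs_filter|exact: H_cont|].
  exact: continuous_dotr.
- move=> p Cp; rewrite dot0r subr0; have := HC p.
  have := le_trans (ler_norm _) (dot_le_norm q p).
  by rewrite mulrDl mul1r; move: Cp; clear; lra.
by exists p => p'; have := Hp p'; clear; lra.
Qed.

Lemma legendre_attained q : exists p, legendre q = dot q p - H p.
Proof. by have [p Hp] := legendre_max q; exists p; rewrite /legendre (sup_max Hp). Qed.

Lemma legendre_ge q p : dot q p - H p <= legendre q.
Proof. by have [p0 Hp] := legendre_max q; rewrite /legendre (sup_max Hp). Qed.

(** The equality case of Fenchel's inequality, which yields the subsolution property of the Hopf-Lax
    function. *)
Lemma legendre_grad p : legendre (DH p) = dot (DH p) p - H p.
Proof.
apply: sup_max => p'; have [->//|/H_conv] := eqVneq p' p.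
by rewrite dotBr; clear; lra.
Qed.

Lemma legendre_convex q q' s : 0 <= s <= 1 ->
  legendre (s *: q + (1 - s) *: q') <= s * legendre q + (1 - s) * legendre q'.
Proof.
move=> /andP[s0 s1]; have [p ->] := legendre_attained (s *: q + (1 - s) *: q').
rewrite dotDl !dotZl.
have : s * (dot q p - H p) <= s * legendre q by rewrite ler_wpM2l// legendre_ge.
have : (1 - s) * (dot q' p - H p) <= (1 - s) * legendre q'.
  by rewrite ler_wpM2l ?subr_ge0// legendre_ge.
by clear; lra.
Qed.

(** Test the supremum at the multiple of [q] of norm [A]; on that ball [H] is at most [H p0]. *)
Lemma legendre_growth : supergrowth legendre.
Proof.
move=> A0; pose A := Num.max A0 0.
have Age0 : 0 <= A by rewrite le_max lexx orbT.
have [|||p0 _ Hp0] := @compact_EVT_max _ _ H [set p | `|p| <= A].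
- by exists 0; rewrite /= normr0.
- exact: compact_norm_le.
- exact: continuous_subspaceT.
exists (H p0) => q; apply: (@le_trans _ _ (A * `|q| - H p0)).
  by rewrite lerD2r ler_wpM2r// le_max lexx.
have [->|q0] := eqVneq q 0.
  rewrite normr0 mulr0; have := legendre_ge 0 0; rewrite dot0l; apply: le_trans.
  by rewrite lerD2l lerN2; apply: Hp0; rewrite inE /= normr0.
have nq0 : 0 < `|q| by rewrite normr_gt0.
have := legendre_ge q ((A / `|q|) *: q); apply: le_trans.
apply: lerB; last first.
  apply: Hp0; rewrite inE /= normrZ ger0_norm ?divfK ?gt_eqF//.
  by rewrite divr_ge0.
rewrite dotZr -mulrA ler_wpM2l// mulrC ler_pdivlMr// -expr2.
exact: norm_le_dot.
Qed.

(* If the excess of H over its supporting plane of slope q at p0 is at least m on the sphere of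
   radius r, convexity makes it at least m * |v| / r at any v outside, so tilting the slope
   by less than m / r keeps the maximisers inside the sphere. *)
Lemma legendre_excess q p0 r : legendre q = dot q p0 - H p0 -> 0 < r ->
  exists2 m, 0 < m & forall v, r <= `|v| ->
    m * `|v| <= legendre q - (dot q (p0 + v) - H (p0 + v)).
Proof.
move=> p0max r0; pose g v := legendre q - (dot q (p0 + v) - H (p0 + v)).
have g_ge0 v : 0 <= g v by rewrite subr_ge0 legendre_ge.
have gs v s : v != 0 -> 0 < s < 1 -> g (s *: v) < s * g v.
  move=> v0 s01; rewrite /g p0max.
  have := @strictly_convex_ineq p0 (p0 + v) s.
  rewrite [p0 + v]addrC addrK -subr_eq0 addrK => /(_ v0 s01).
  by rewrite ![v + p0]addrC !dotDr !dotZr; clear; lra.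
have g_gt0 v : v != 0 -> 0 < g v.
  move=> v0; have h : 0 < (2^-1 : R) < 1 by apply/andP; split; lra.
  by have := gs v _ v0 h; have := g_ge0 (2^-1 *: v); lra.
suff [m m0 gm] : exists2 m, 0 < m & forall v, `|v| = r -> m <= g v.
  exists (m / r); first by rewrite divr_gt0.
  move=> v rv; rewrite -/(g v); have v0 : v != 0 by rewrite -normr_gt0; apply: lt_le_trans rv.
  have nv0 : 0 < `|v| by rewrite normr_gt0.
  have : m <= g ((r / `|v|) *: v).
    by apply: gm; rewrite normrZ ger0_norm ?divfK ?gt_eqF// divr_ge0// ltW.
  rewrite mulrAC ler_pdivrMr// => mg.
  have [rv1|rv1] := eqVneq r `|v|.
    move: mg; rewrite rv1 divff ?gt_eqF// scale1r => mg.
    by rewrite mulrC [g v * _]mulrC ler_wpM2l.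
  have := gs v (r / `|v|) v0.
  rewrite divr_gt0// ltr_pdivrMr// mul1r lt_neqAle rv1 rv => /(_ isT) gsv.
  by have := le_trans mg (ltW gsv); rewrite mulrAC ler_pdivlMr// mulrC [g v * _]mulrC.
(* In dimension 0 the sphere is empty. *)
have [[v0 v0r]|noS] := pselect (exists v : 'rV[R]_n, `|v| = r); last first.
  by exists 1 => // v vr; exfalso; apply: noS; exists v.
have [|||v1] := @compact_EVT_min _ _ g [set v | `|v| = r].
- by exists v0.
- apply: bounded_closed_compact.
    by exists r; split=> [|M rM p /= ->]; rewrite ?num_real// ltW.
  apply: (@closed_comp _ _ _ [set x | x = r]); last exact: closed_eq.
  by move=> p _; exact: norm_continuous.
- apply: continuous_subspaceT => v.
  apply: (@continuousB _ _ _ (cst (legendre q)) (fun v => dot q (p0 + v) - H (p0 + v)) v).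
    exact: cst_continuous.
  apply: (@continuous_comp _ _ _ (fun v => p0 + v) (fun p => dot q p - H p) v).
    apply: (@continuousD _ _ _ (cst p0) id v); first exact: cst_continuous.
    exact: cvg_id.
  by apply: (@continuousB _ _ _ (dot q) H); [exact: continuous_dotr|exact: H_cont].
rewrite inE /= => v1r Hv1; exists (g v1); first by rewrite g_gt0// -normr_gt0 v1r.
by move=> v vr; apply: Hv1; rewrite inE.
Qed.

(** Let [p0 + v] be a maximiser for [q + h]. If [v] is small, [dot h v] is within the error; if it
    is large, the excess [m * |v|] outweighs [dot h v]. *)
Lemma legendre_differential q p0 e : legendre q = dot q p0 - H p0 -> 0 < e ->
  exists2 d, 0 < d & forall h, `|h| < d ->
    legendre (q + h) - legendre q <= dot h p0 + e * `|h|.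
Proof.
move=> p0max e0; pose N : R := n%:R + 1.
have N0 : 0 < N by rewrite ltr_wpDl.
have [m m0 Hm] := legendre_excess p0max (divr_gt0 e0 N0).
exists (m / N); first by rewrite divr_gt0.
move=> h; rewrite ltr_pdivlMr// => hm.
have [p ->] := legendre_attained (q + h).
pose v := p - p0; have pE : p = p0 + v by rewrite /v addrC subrK.
have hv : dot h v <= N * `|h| * `|v|.
  apply: le_trans (ler_norm _) (le_trans (dot_le_norm _ _) _).
  by rewrite -!mulrA ler_wpM2r ?mulr_ge0// lerDl.
have h0 := normr_ge0 h; have v0 := normr_ge0 v.
have eh0 : 0 <= e * `|h| by rewrite mulr_ge0// ltW.
rewrite pE dotDl [dot h _]dotDr.
have [rv|rv] := leP (e / N) `|v|.
  have := Hm v rv; have : `|h| * N * `|v| <= m * `|v| by rewrite ler_wpM2r// ltW.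
  by rewrite [_ * N]mulrC; move: hv eh0; clear; lra.
have := legendre_ge q (p0 + v).
have : N * `|h| * `|v| <= N * `|h| * (e / N) by rewrite ler_wpM2l ?mulr_ge0// ltW.
have -> : N * `|h| * (e / N) = e * `|h| by field; rewrite gt_eqF.
by move: hv; clear; lra.
Qed.

Lemma legendre_subdiff q p h : legendre q = dot q p - H p ->
  dot h p <= legendre (q + h) - legendre q.
Proof. by move=> ->; have := legendre_ge (q + h) p; rewrite dotDl; clear; lra. Qed.

Lemma legendre_continuous : continuous legendre.
Proof.
apply: continuous_epsdelta => q e e0.
have [p pq] := legendre_attained q.
have [d d0 Hd] := legendre_differential pq ltr01.
pose N : R := n%:R * `|p| + 1; have N0 : 0 < N by rewrite ltr_wpDl ?mulr_ge0.
exists (Num.min d (e / N)); first by rewrite lt_min d0 divr_gt0.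
move=> q'; rewrite lt_min => /andP[qd]; rewrite ltr_pdivlMr// => qe.
pose h := q' - q; have -> : q' = q + h by rewrite /h addrC subrK.
rewrite distrC; have nh : `|h| = `|q - q'| by rewrite distrC.
have := Hd h; rewrite nh => /(_ qd); have := legendre_subdiff h pq.
have := dot_le_norm h p; rewrite ler_norml nh => /andP[].
rewrite ltr_norml; move: qe; rewrite /N; move: (normr_ge0 (q - q')) => a0 qe *.
by apply/andP; split; lra.
Qed.

End legendre.

(** * Hopf-Lax formula *)

Section line.
Context {R : realType} {V : normedModType R}.

Lemma derive_ge (f : V -> R) x v c : derivable f x v ->
  (\forall h \near 0^'+, f x + h * c <= f (x + h *: v)) -> c <= 'D_v f x.
Proof.
move=> fd fc; rewrite -lerN2 -deriveN//; apply: derive_le; first exact: derivableN.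
by apply: filterS fc => h; rewrite mulrN -opprD lerN2.
Qed.

Lemma near_line (x v : V) (P : V -> Prop) :
  (\forall z \near x, P z) -> \forall h \near 0^'+, P (x + h *: v).
Proof.
have cv : x + h *: v @[h --> 0^'+] --> x.
  apply: cvg_at_right_filter; rewrite -[X in _ --> X]addr0 -(scale0r v).
  apply: cvgD; first exact: cvg_cst.
  by apply: cvgZr_tmp; exact: cvg_id.
exact: cv.
Qed.

End line.

Section space_time.
Context {R : realType} {n : nat}.
Implicit Types (phi : R * 'rV[R]_n -> R).

Lemma derive_space_time phi t x s q : differentiable phi (t, x) ->
  'D_(s, q) phi (t, x) =
  s * derive1 (fun t => phi (t, x)) t + dot (grad (fun x => phi (t, x)) x) q.
Proof.
move=> dphi.
have dx : differentiable (fun x => phi (t, x)) x.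
  exact: (@differentiable_comp R _ _ _ (fun x => (t, x)) phi).
have -> : (s, q) = s *: (1, 0) + (0, q) :> R * 'rV[R]_n.
  by change ((s, q) = (s * 1 + 0, s *: 0 + q)); rewrite scaler0 mulr1 addr0 add0r.
rewrite deriveE// linearD linearZ/= -!deriveE// -deriv_dot// derive1E; congr (_ * _ + _).
  have E : (fun h : R => h^-1 *: ((phi \o shift (t, x)) (h *: (1, 0)) - phi (t, x))) =
      (fun h : R => h^-1 *: (((fun t => phi (t, x)) \o shift t) (h *: 1) - phi (t, x))).
    apply/funext => h /=.
    change (h^-1 *: (phi (h *: 1 + t, h *: 0 + x) - phi (t, x)) =
            h^-1 *: (phi (h *: 1 + t, x) - phi (t, x))).
    by rewrite scaler0 add0r.
  by rewrite /derive E.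
have E : (fun h : R => h^-1 *: ((phi \o shift (t, x)) (h *: (0, q)) - phi (t, x))) =
    (fun h : R => h^-1 *: (((fun x => phi (t, x)) \o shift x) (h *: q) - phi (t, x))).
  apply/funext => h /=.
  change (h^-1 *: (phi (h * 0 + t, h *: q + x) - phi (t, x)) =
          h^-1 *: (phi (t, h *: q + x) - phi (t, x))).
  by rewrite mulr0 add0r.
by rewrite /derive E.
Qed.

End space_time.

Section hopf_lax.
Context {R : realType} {n : nat}.
Variables (H : 'rV[R]_n -> R) (DH : 'rV[R]_n -> 'rV[R]_n).
Hypotheses (H_cont : continuous H) (H_conv : strictly_convex H DH) (H_growth : supergrowth H).
Variables (u0 : 'rV[R]_n -> R) (K : R).
Hypotheses (K_ge0 : 0 <= K) (u0_lip : forall x y, `|u0 x - u0 y| <= K * `|x - y|).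
Implicit Types (s t : R) (x y q : 'rV[R]_n).

Local Notation L := (legendre H).

(** Minimising over the velocity [q = (x - y) / t] instead of over [y] keeps the formula meaningful
    at [t = 0], where it returns [u0]. *)
Definition hopf_lax t x : R := inf (range (fun q => u0 (x - t *: q) + t * L q)).

Lemma hopf_lax_min t x : 0 <= t ->
  exists q, forall q', u0 (x - t *: q) + t * L q <= u0 (x - t *: q') + t * L q'.
Proof.
rewrite le_eqVlt => /orP[/eqP <-|t0].
  by exists 0 => q'; rewrite !scale0r !mul0r.
have [C HC] := legendre_growth H_cont H_growth (K + 1).
pose f q := u0 (x - t *: q) + t * L q.
apply: (@coercive_min _ _ f (C + L 0)).
  move=> q; apply: (@continuousD _ _ _ (fun q => u0 (x - t *: q)) (fun q => t * L q)).
    apply: (@continuous_comp _ _ _ (fun q => x - t *: q) u0); last exact: (lipschitz_continuous K_ge0 u0_lip).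
    apply: (@continuousB _ _ _ (cst x) (fun q => t *: q)); first exact: cst_continuous.
    exact: scaler_continuous.
  apply: (@continuousM _ _ (cst t) L); first exact: cst_continuous.
  exact: (legendre_continuous H_cont H_conv H_growth).
move=> q Cq; rewrite /f scaler0 subr0.
have := lipschitz_le u0_lip x (x - t *: q); rewrite subKr normrZ gtr0_norm// => H1.
have : t * ((K + 1) * `|q| - C) <= t * L q by rewrite ler_wpM2l ?HC// ltW.
have : t * (C + L 0) <= t * `|q| by rewrite ler_wpM2l// ltW.
by move: H1; lra.
Qed.

Lemma hopf_lax_attained t x : 0 <= t -> exists q, hopf_lax t x = u0 (x - t *: q) + t * L q.
Proof. by move=> /(hopf_lax_min x)[q Hq]; exists q; rewrite /hopf_lax (inf_min Hq). Qed.

Lemma hopf_lax_le t x q : 0 <= t -> hopf_lax t x <= u0 (x - t *: q) + t * L q.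
Proof. by move=> /(hopf_lax_min x)[q' Hq]; rewrite /hopf_lax (inf_min Hq). Qed.

Lemma hopf_lax0 x : hopf_lax 0 x = u0 x.
Proof. by have [q ->] := hopf_lax_attained x (lexx 0); rewrite scale0r mul0r subr0 addr0. Qed.

Lemma hopf_lax_lip t x y : 0 <= t -> hopf_lax t x <= hopf_lax t y + K * `|x - y|.
Proof.
move=> t0; have [q ->] := hopf_lax_attained y t0.
apply: le_trans (hopf_lax_le x q t0) _.
have := lipschitz_le u0_lip (x - t *: q) (y - t *: q).
by rewrite opprB addrA subrK; lra.
Qed.

(** Run [q'] up to time [s] and then [q]: by convexity of [L], moving at the average velocity costs
    no more. *)
Lemma hopf_lax_step s t x q : 0 <= s -> s <= t ->
  hopf_lax t x <= hopf_lax s (x - (t - s) *: q) + (t - s) * L q.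
Proof.
move=> s0 st; have [q' ->] := hopf_lax_attained (x - (t - s) *: q) s0.
have t0 := le_trans s0 st.
have [tE|tn0] := eqVneq t 0.
  have -> : s = t by apply: le_anti; rewrite st tE s0.
  rewrite tE hopf_lax0 subrr !scale0r !mul0r !subr0 !addr0.
  exact: lexx.
have tgt0 : 0 < t by rewrite lt_def tn0.
pose a := (t - s) / t; have a01 : 0 <= a <= 1.
  rewrite divr_ge0 ?subr_ge0//= ler_pdivrMr// mul1r.
  by move: s0; lra.
apply: le_trans (hopf_lax_le x (a *: q + (1 - a) *: q') t0) _.
have ta : t * a = t - s by rewrite /a mulrC divfK.
have ta1 : t * (1 - a) = s by rewrite mulrBr mulr1 ta subKr.
rewrite scalerDr !scalerA ta ta1 opprD addrA.
have := legendre_convex H_cont H_growth q q' a01.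
rewrite -(ler_pM2l tgt0) mulrDr (mulrA t a) (mulrA t (1 - a)) ta ta1.
lra.
Qed.

(** The velocity optimal at [(t, x)] is still a competitor at every earlier point of its straight
    ray, so one [q] serves all [s]. *)
Lemma hopf_lax_back t x : 0 <= t -> exists q, forall s, 0 <= s <= t ->
  hopf_lax s (x - (t - s) *: q) + (t - s) * L q <= hopf_lax t x.
Proof.
move=> t0; have [q qE] := hopf_lax_attained x t0; exists q => s /andP[s0 st].
have := hopf_lax_le (x - (t - s) *: q) q s0.
by rewrite qE -addrA -opprD -scalerDl subrK; lra.
Qed.

(** Staying at rest bounds the increase. For the decrease, [L q >= K * |q| - C] absorbs what the
    Lipschitz datum can gain by moving. *)
Lemma hopf_lax_time : exists2 C, 0 <= C & forall s t x, 0 <= s <= t ->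
  `|hopf_lax t x - hopf_lax s x| <= C * (t - s).
Proof.
have [C HC] := legendre_growth H_cont H_growth K.
exists (Num.max `|C| `|L 0|); first by rewrite le_max normr_ge0.
move=> s t x /andP[s0 st]; have ts : 0 <= t - s by rewrite subr_ge0.
rewrite ler_norml; apply/andP; split.
  have [q /(_ s)] := hopf_lax_back x (le_trans s0 st); rewrite s0 st => /(_ isT).
  have := hopf_lax_lip x (x - (t - s) *: q) s0.
  rewrite subKr normrZ ger0_norm//.
  have : (t - s) * (K * `|q| - C) <= (t - s) * L q by rewrite ler_wpM2l.
  have : (t - s) * C <= (t - s) * Num.max `|C| `|L 0|.
    by rewrite ler_wpM2l// le_max ler_norm.
  by lra.
have := hopf_lax_step x 0 s0 st; rewrite scaler0 subr0.
have : (t - s) * L 0 <= (t - s) * Num.max `|C| `|L 0|.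
  by rewrite ler_wpM2l// le_max ler_norm orbT.
by lra.
Qed.

Lemma hopf_lax_uc T : unif_continuous_on (strip T) (fun z => hopf_lax z.1 z.2).
Proof.
have [C C0 HC] := hopf_lax_time; move=> e e0.
have N0 : 0 < C + K + 1 by rewrite ltr_wpDl// addr_ge0.
exists (e / (C + K + 1)); first by rewrite divr_gt0.
move=> [t x] [s y] /andP[/= t0 _] /andP[/= s0 _]; rewrite ltr_pdivlMr// prod_normE /=.
set d := Num.max _ _ => de.
have d1 : `|t - s| <= d by rewrite le_max lexx.
have d2 : `|x - y| <= d by rewrite le_max lexx orbT.
have d0 : 0 <= d by apply: le_trans d1.
have Ht : `|hopf_lax t x - hopf_lax s x| <= C * d.
  have [st|/ltW ts] := leP s t.
    by apply: le_trans (HC s t x _) _; rewrite ?s0// ler_wpM2l// (le_trans (ler_norm _)).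
  rewrite distrC; apply: le_trans (HC t s x _) _; rewrite ?t0// ler_wpM2l//.
  by rewrite -opprB (le_trans _ d1)// -normrN ler_norm.
have Hx : `|hopf_lax s x - hopf_lax s y| <= K * d.
  apply: (@le_trans _ _ (K * `|x - y|)); last by rewrite ler_wpM2l.
  have := hopf_lax_lip x y s0; have := hopf_lax_lip y x s0; rewrite (distrC y x) ler_norml.
  by move=> *; apply/andP; split; lra.
have -> : hopf_lax t x - hopf_lax s y =
  (hopf_lax t x - hopf_lax s x) + (hopf_lax s x - hopf_lax s y) by ring.
apply: le_lt_trans (ler_normD _ _) _.
by move: Ht Hx de d0; lra.
Qed.

(** Go back along the ray of velocity [DH p], where [p] is the spatial gradient of the test
    function, and use equality in Fenchel's inequality. *)
Lemma hopf_lax_sub T : subsolution H T (fun z => hopf_lax z.1 z.2).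
Proof.
move=> phi t x /(_ 1%N)[dphi _] /andP[t0 tT] umax.
pose p := grad (fun x => phi (t, x)) x; pose q := DH p.
have : - L q <= 'D_(-1, - q) phi (t, x).
  apply: derive_ge; first exact: diff_derivable.
  have Hline := @near_line R (R * 'rV[R]_n)%type (t, x) (-1, - q) _ umax.
  near=> h; have ht : h < t by near: h; exact: nbhs_right_lt.
  have h0 : 0 < h by near: h; exact: nbhs_right_gt.
  have zE : (t, x) + h *: (-1, - q) = (t - h, x - h *: q).
    by change ((t + h * -1, x + h *: - q) = (t - h, x - h *: q)); rewrite mulrN mulr1 scalerN.
  rewrite zE mulrN; have : let z := (t, x) + h *: (-1, - q) in
      hopf_lax z.1 z.2 - phi z <= hopf_lax t x - phi (t, x) by near: h; exact: Hline.
  rewrite zE /=.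
  have := @hopf_lax_step (t - h) t x q; rewrite subKr subr_ge0 (ltW ht) lerBlDr lerDl (ltW h0).
  move=> /(_ isT isT); lra.
rewrite derive_space_time//; rewrite dotNr -/p /pde -/p /q (legendre_grad H_conv) dotC.
by lra.
Unshelve. all: by end_near. Qed.

(** Go back along the optimal ray instead; Fenchel's inequality is then enough. *)
Lemma hopf_lax_super T : supersolution H T (fun z => hopf_lax z.1 z.2).
Proof.
move=> phi t x /(_ 1%N)[dphi _] /andP[t0 tT] umin.
pose p := grad (fun x => phi (t, x)) x.
have [q Hq] := hopf_lax_back x (ltW t0).
have : 'D_(-1, - q) phi (t, x) <= - L q.
  apply: derive_le; first exact: diff_derivable.
  have Hline := @near_line R (R * 'rV[R]_n)%type (t, x) (-1, - q) _ umin.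
  near=> h; have ht : h < t by near: h; exact: nbhs_right_lt.
  have h0 : 0 < h by near: h; exact: nbhs_right_gt.
  have zE : (t, x) + h *: (-1, - q) = (t - h, x - h *: q).
    by change ((t + h * -1, x + h *: - q) = (t - h, x - h *: q)); rewrite mulrN mulr1 scalerN.
  rewrite zE mulrN; have : let z := (t, x) + h *: (-1, - q) in
      hopf_lax t x - phi (t, x) <= hopf_lax z.1 z.2 - phi z by near: h; exact: Hline.
  rewrite zE /=.
  have := Hq (t - h); rewrite subKr subr_ge0 (ltW ht) lerBlDr lerDl (ltW h0).
  move=> /(_ isT); lra.
have := legendre_ge H_cont H_growth q p.
rewrite derive_space_time//; rewrite dotNr -/p /pde -/p dotC.
by lra.
Unshelve. all: by end_near. Qed.

Lemma hopf_lax_solution T : viscosity_solution H T (fun z => hopf_lax z.1 z.2).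
Proof.
apply/viscosity_solutionP; split; [exact: hopf_lax_uc|exact: hopf_lax_sub|exact: hopf_lax_super].
Qed.

Lemma Splus_hopf_lax T : 0 < T -> Splus H T u0 = hopf_lax T.
Proof.
move=> T0; apply/funext => x; rewrite /Splus.
have ex : exists u, viscosity_solution H T u /\ forall x, u (0, x) = u0 x.
  exists (fun z => hopf_lax z.1 z.2); split; [exact: hopf_lax_solution|exact: hopf_lax0].
have [usol u0E] := xgetPex (cst 0) ex.
apply: (viscosity_unique T0 H_cont usol (hopf_lax_solution T)).
  by move=> y; rewrite u0E /= hopf_lax0.
by rewrite lexx ltW.
Qed.

End hopf_lax.

(** * Backward solutions *)

Section reflection.
Context {R : realType} {n : nat}.
Implicit Types (F H : 'rV[R]_n -> R) (p q : 'rV[R]_n).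

Definition reflect_fun F p := F (- p).

Lemma reflect_fun_continuous F : continuous F -> continuous (reflect_fun F).
Proof.
move=> Fc p; apply: (@continuous_comp _ _ _ (fun p : 'rV[R]_n => - p) F); last exact: Fc.
exact: opp_continuous.
Qed.

Lemma reflect_fun_strictly_convex H DH : strictly_convex H DH ->
  strictly_convex (reflect_fun H) (fun p => - DH (- p)).
Proof.
move=> Hc p p' pp'; have /Hc : - p' != - p by rewrite eqr_opp.
by rewrite -opprD !(dotNl, dotNr).
Qed.

Lemma reflect_fun_growth H : supergrowth H -> supergrowth (reflect_fun H).
Proof. by move=> Hg A; have [C HC] := Hg A; exists C => p; rewrite -normrN; exact: HC. Qed.

Lemma legendre_reflect_fun H q : legendre (reflect_fun H) q = legendre H (- q).
Proof.
rewrite /legendre; congr sup; apply/seteqP; split=> _ [p _ <-]; exists (- p) => //.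
  by rewrite dotNl dotNr opprK.
by rewrite /reflect_fun opprK dotNl dotNr.
Qed.

Lemma pdeN F phi t x : Cinfty phi ->
  pde F (fun z => - phi z) t x = - pde (fun p => - F (- p)) phi t x.
Proof.
move=> phi_smooth; have [dphi _] := phi_smooth 1%N.
have [dNphi _] := CinftyN phi_smooth 1%N.
have dN s q : s * derive1 (fun t => - phi (t, x)) t + dot (grad (fun x => - phi (t, x)) x) q =
    - (s * derive1 (fun t => phi (t, x)) t + dot (grad (fun x => phi (t, x)) x) q).
  rewrite -(@derive_space_time _ _ (fun z => - phi z))// -derive_space_time//.
  by rewrite deriveN//; exact: diff_derivable.
have gE : grad (fun x => - phi (t, x)) x = - grad (fun x => phi (t, x)) x.
  apply/rowP => i; have := dN 0 (delta_mx 0 i).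
  by rewrite !mul0r !add0r !dot_delta => ->; rewrite [RHS]mxE.
rewrite /pde gE; have := dN 1 0; rewrite !mul1r !dot0r !addr0 => ->.
by rewrite opprD opprK.
Qed.

(** The change of sign exchanges maxima with minima, and so the two halves of the definition. *)
Lemma viscosity_solutionN F T v : viscosity_solution F T v ->
  viscosity_solution (fun p => - F (- p)) T (fun z => - v z).
Proof.
move=> /viscosity_solutionP[uc vsub vsup]; apply/viscosity_solutionP; split.
- move=> e /uc[d d0 vd]; exists d => // x y xT yT xy.
  by rewrite -opprD normrN; exact: vd.
- move=> phi t x Hphi tT vmax; rewrite -oppr_ge0 -pdeN//; apply: vsup => //.
    exact: CinftyN.
  by apply: filterS vmax => z; lra.
- move=> phi t x Hphi tT vmin; rewrite -oppr_le0 -pdeN//; apply: vsub => //.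
    exact: CinftyN.
  by apply: filterS vmin => z; lra.
Qed.

End reflection.

Section backward.
Context {R : realType} {n : nat}.
Variables (H : 'rV[R]_n -> R) (DH : 'rV[R]_n -> 'rV[R]_n).
Hypotheses (H_cont : continuous H) (H_conv : strictly_convex H DH) (H_growth : supergrowth H).
Variables (uT : 'rV[R]_n -> R) (K : R).
Hypotheses (K_ge0 : 0 <= K) (uT_lip : forall x y, `|uT x - uT y| <= K * `|x - y|).
Variables (T : R).
Hypothesis T_gt0 : 0 < T.
Implicit Types (x q : 'rV[R]_n).

Let NuT x := - uT x.

Let NuT_lip x y : `|NuT x - NuT y| <= K * `|x - y|.
Proof. by rewrite /NuT -opprD normrN. Qed.

(* If w is a backward solution for H, then (t, x) |-> - w (T - t, x) is a forward solution for
   the reflected Hamiltonian p |-> H (- p). *)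
Lemma Sminus_hopf_lax x : Sminus H T uT x = - hopf_lax (reflect_fun H) NuT T x.
Proof.
have Rc := reflect_fun_continuous H_cont.
have Rv := reflect_fun_strictly_convex H_conv.
have Rg := reflect_fun_growth H_growth.
have hl_sol := hopf_lax_solution Rc Rv Rg K_ge0 NuT_lip T.
rewrite /Sminus; set Q := (X in xget _ X).
have ex : exists w, Q w.
  exists (fun z => - hopf_lax (reflect_fun H) NuT (T - z.1) z.2); split=> [|y]; last first.
    by rewrite /= subrr (hopf_lax0 Rc Rv Rg K_ge0 NuT_lip) /NuT opprK.
  have := viscosity_solutionN hl_sol.
  congr (viscosity_solution _ _ _); apply/funext => z; first by rewrite /reflect_fun opprK.
  by rewrite /= subKr.
have [wsol wE] := xgetPex (cst 0) ex.
set w := xget _ _ in wsol wE *.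
have Nw : viscosity_solution (reflect_fun H) T (fun z => - w (T - z.1, z.2)).
  have := viscosity_solutionN wsol.
  by congr (viscosity_solution _ _ _); apply/funext => p; rewrite opprK.
have := viscosity_unique T_gt0 Rc Nw hl_sol _ x (t := T).
rewrite /= subrr lexx (ltW T_gt0) => <- //; first by rewrite opprK.
by move=> y; rewrite /= subr0 wE (hopf_lax0 Rc Rv Rg K_ge0 NuT_lip).
Qed.

Lemma Sminus_ge x q : uT (x + T *: q) - T * legendre H q <= Sminus H T uT x.
Proof.
rewrite Sminus_hopf_lax lerNr.
have := hopf_lax_le (reflect_fun_continuous H_cont) (reflect_fun_strictly_convex H_conv)
  (reflect_fun_growth H_growth) K_ge0 NuT_lip x (- q) (ltW T_gt0).
by rewrite legendre_reflect_fun opprK scalerN opprK /NuT; lra.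
Qed.

Lemma Sminus_attained x : exists q, Sminus H T uT x = uT (x + T *: q) - T * legendre H q.
Proof.
have [q qE] := hopf_lax_attained (reflect_fun_continuous H_cont)
  (reflect_fun_strictly_convex H_conv) (reflect_fun_growth H_growth) K_ge0 NuT_lip x (ltW T_gt0).
exists (- q); rewrite Sminus_hopf_lax.
by move: qE; rewrite legendre_reflect_fun scalerN /NuT => ->; ring.
Qed.

End backward.

Section differentiability.
Context {R : realType}.

Lemma differentiable_epsdelta {V : normedModType R} (f : V -> R) (df : {linear V -> R}) x :
  continuous df ->
  (forall e, 0 < e -> exists2 d, 0 < d &
     forall h, `|h| < d -> `|f (x + h) - f x - df h| <= e * `|h|) ->
  differentiable f x.
Proof.
move=> dfc fe.
have fE : f \o shift x = cst (f x) + df +o_ 0 id.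
  apply/eqaddoP => e /fe[d d0 fd]; apply/nbhs_normP; exists d => // h.
  rewrite /ball_ /= sub0r normrN => /fd; rewrite [x + h]addrC.
  by rewrite -[(f \o shift x - _) h]/(f (h + x) - (f x + df h)) opprD addrA.
have dE := diff_unique dfc fE.
by apply/diff_locallyP; rewrite dE.
Qed.

Lemma differentiable_dot {n} (f : 'rV[R]_n -> R) p x :
  (forall e, 0 < e -> exists2 d, 0 < d &
     forall h, `|h| < d -> `|f (x + h) - f x - dot p h| <= e * `|h|) ->
  differentiable f x.
Proof.
have lin : linear (dot p) by move=> a u v; rewrite dotDr dotZr.
pose linM := GRing.isLinear.Build _ _ _ _ _ lin.
pose linL : {linear _ -> _} := HB.pack (dot p) linM.
move=> fe; apply: (@differentiable_epsdelta _ f linL) => //.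
exact: continuous_dotr.
Qed.

End differentiability.

(** * Gradients and minimisers *)

Section characteristics.
Context {R : realType} {n : nat}.
Variables (H : 'rV[R]_n -> R).
Hypotheses (H_diff : forall p, differentiable H p)
  (H_conv : strictly_convex H (grad H)) (H_growth : supergrowth H).
Variables (u0 : 'rV[R]_n -> R) (K : R).
Hypotheses (K_ge0 : 0 <= K) (u0_lip : forall x y, `|u0 x - u0 y| <= K * `|x - y|).
Variable T : R.
Hypothesis T_gt0 : 0 < T.
Implicit Types (x y z p q : 'rV[R]_n).

Local Notation L := (legendre H).
Local Notation uT := (hopf_lax H u0 T).

Let H_cont : continuous H.
Proof. by move=> p; exact: differentiable_continuous. Qed.

(** First-order condition at the maximiser [p], tested only in the direction [q - grad H p]. *)
Lemma legendre_eq_grad q p : L q <= dot q p - H p -> q = grad H p.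
Proof.
move=> Lq; apply/eqP; rewrite -subr_eq0; apply/negPn/negP => /dot_gt0.
set v := q - grad H p; suff : dot q v <= dot (grad H p) v.
  by rewrite {2}/v dotBl; lra.
rewrite -deriv_dot//; apply: derive_ge; first exact: diff_derivable.
apply: nearW => h; have := legendre_ge H_cont H_growth q (p + h *: v).
by rewrite dotDr dotZr; lra.
Qed.

(** Shift the endpoint by [h T (q' - q)] and the velocity by [h (q' - q)]: the starting point
    [z - T q] is unchanged, [u0] drops out, and [grad uT z] becomes a subgradient of [L] at [q]. *)
Lemma minimizer_grad z q : differentiable uT z -> uT z = u0 (z - T *: q) + T * L q ->
  q = grad H (grad uT z).
Proof.
move=> duT qmin; set p := grad uT z.
have subdiff q' : dot p (q' - q) <= L q' - L q.
  rewrite -(ler_pM2l T_gt0) -dotZr -deriv_dot//.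
  apply: derive_le; first exact: diff_derivable.
  near=> h; have h0 : 0 <= h by apply: ltW; near: h; exact: nbhs_right_gt.
  have h1 : h <= 1 by apply: ltW; near: h; exact: nbhs_right_lt.
  have := hopf_lax_le H_cont H_conv H_growth K_ge0 u0_lip (z + h *: (T *: (q' - q)))
    (q + h *: (q' - q)) (ltW T_gt0).
  have -> : z + h *: (T *: (q' - q)) - T *: (q + h *: (q' - q)) = z - T *: q.
    rewrite (scalerDr T q); move: (q' - q) => w.
    by rewrite !scalerA [h * T]mulrC opprD addrACA subrr addr0.
  have h01 : 0 <= h <= 1 by rewrite h0.
  have := legendre_convex H_cont H_growth q' q h01.
  have -> : h *: q' + (1 - h) *: q = q + h *: (q' - q).
    by rewrite scalerBl scale1r scalerBr addrCA.
  rewrite -(ler_pM2l T_gt0) => convL.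
  by rewrite qmin; move: convL; lra.
(* At [q' = grad H p] Fenchel's inequality is an equality, so the subgradient inequality bounds
   [L q] from above. *)
apply: legendre_eq_grad.
have := subdiff (grad H p); rewrite (legendre_grad H_conv) dotBr.
by rewrite !(dotC p); lra.
Unshelve. all: by end_near. Qed.

(* At a minimum point of uT + M |. - z0|^2 the function uT is squeezed between a paraboloid
   and T L((. - y) / T) + u0(y), both differentiable there. *)
Lemma hopf_lax_differentiable_dense z0 e : 0 < e ->
  exists2 z, `|z - z0| < e & differentiable uT z.
Proof.
(* The Lipschitz bound confines the minimiser to radius [K / M], which this choice makes less than
   [e]. *)
move=> e0; pose M := (K + 1) / e.
have M0 : 0 < M by rewrite divr_gt0// ltr_wpDl.
have uT_lip x y : uT x <= uT y + K * `|x - y|.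
  exact: (hopf_lax_lip H_cont H_conv H_growth K_ge0 u0_lip _ _ (ltW T_gt0)).
have uT_cont : continuous uT.
  apply: (@lipschitz_continuous _ _ _ K K_ge0) => x y; rewrite ler_norml.
  by have := uT_lip x y; have := uT_lip y x; rewrite (distrC y x) => *; apply/andP; split; lra.
have grow v : uT (z0 + v) + M * dot v v <= uT z0 -> `|v| <= K / M.
  move=> Hv; have [->|v0] := eqVneq v 0; first by rewrite normr0 divr_ge0// ltW.
  have nv0 : 0 < `|v| by rewrite normr_gt0.
  rewrite ler_pdivlMr// -(ler_pM2r nv0) mulrAC -expr2 mulrC.
  have : M * `|v| ^+ 2 <= M * dot v v by rewrite ler_wpM2l ?norm_le_dot// ltW.
  have := uT_lip z0 (z0 + v); rewrite opprD addrA subrr sub0r normrN.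
  by move: Hv; lra.
have [||v vmin] := @coercive_min _ _ (fun v => uT (z0 + v) + M * dot v v) (K / M).
- move=> v; apply: (@continuousD _ _ _ (fun v => uT (z0 + v)) (fun v => M * dot v v)).
    apply: (@continuous_comp _ _ _ (fun v => z0 + v) uT); last exact: uT_cont.
    apply: (@continuousD _ _ _ (cst z0) id v); first exact: cst_continuous.
    exact: cvg_id.
  apply: (@continuousM _ _ (cst M) (fun v => dot v v)); first exact: cst_continuous.
  by apply: (@continuous_dot2 _ _ _ id id) => w; exact: cvg_id.
- move=> v Kv; rewrite addr0 dot0l mulr0 addr0 leNgt; apply/negP => /ltW/grow.
  by rewrite leNgt Kv.
have vK : `|v| <= K / M.
  by apply: grow; have := vmin 0; rewrite addr0 dot0l mulr0 addr0.
exists (z0 + v).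
  rewrite addrC addKr; apply: le_lt_trans vK _; rewrite ltr_pdivrMr// /M mulrC divfK ?gt_eqF//.
  by rewrite ltrDl.
set z := z0 + v.
have lower h : uT z - 2 * M * dot v h - M * dot h h <= uT (z + h).
  have := vmin (v + h); rewrite /z addrA !(dotDl, dotDr) (dotC h v); lra.
have [q qmin] := hopf_lax_attained H_cont H_conv H_growth K_ge0 u0_lip z (ltW T_gt0).
have [p pq] := legendre_attained H_cont H_growth q.
have upper a : 0 < a -> exists2 d, 0 < d & forall h, `|h| < d ->
    uT (z + h) - uT z <= dot p h + a * `|h|.
  move=> a0; have [d d0 Hd] := legendre_differential H_cont H_conv H_growth pq a0.
  exists (T * d); first by rewrite mulr_gt0.
  move=> h hd; have nh : `|T^-1 *: h| = `|h| / T.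
    by rewrite normrZ ger0_norm ?invr_ge0 ?(ltW T_gt0)// mulrC.
  have := Hd (T^-1 *: h); rewrite nh ltr_pdivrMr// [d * T]mulrC => /(_ hd).
  rewrite -(ler_pM2l T_gt0) dotZl.
  have -> : T * (T^-1 * dot h p + a * (`|h| / T)) = dot h p + a * `|h|.
    by field; rewrite gt_eqF.
  have := hopf_lax_le H_cont H_conv H_growth K_ge0 u0_lip (z + h) (q + T^-1 *: h) (ltW T_gt0).
  rewrite scalerDr scalerA divff ?gt_eqF// scale1r opprD addrACA subrr addr0 qmin.
  by rewrite (dotC p); lra.
(* The slopes of the two bounds must agree: if their difference [w] were nonzero, a short step
   [s *: w] would give [dot w w <= dot w w / 2], each error term being a quarter. *)
have pE : p = - (2 * M) *: v.
  apply/eqP; rewrite eq_sym -subr_eq0; apply/negPn/negP => w0.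
  set w := _ - p in w0; have ww := dot_gt0 w0.
  have nw : 0 < `|w| by rewrite normr_gt0.
  have a0 : 0 < dot w w / (4 * `|w|) by rewrite divr_gt0// mulr_gt0.
  have [d d0 Hd] := upper _ a0.
  pose s := Num.min (1 / (4 * M)) (d / (2 * `|w|)).
  have s0 : 0 < s by rewrite lt_min !divr_gt0// mulr_gt0.
  have sM : s * M <= 1 / 4.
    have -> : 1 / 4 = 1 / (4 * M) * M by field; rewrite gt_eqF.
    by rewrite ler_wpM2r ?(ltW M0)// ge_min lexx.
  have sw : s * `|w| < d.
    apply: (@le_lt_trans _ _ (d / (2 * `|w|) * `|w|)).
      by rewrite ler_wpM2r ?(ltW nw)// ge_min lexx orbT.
    have -> : d / (2 * `|w|) * `|w| = d / 2 by field; rewrite gt_eqF.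
    by lra.
  have := Hd (s *: w); rewrite normrZ ger0_norm ?(ltW s0)// => /(_ sw).
  have -> : dot w w / (4 * `|w|) * (s * `|w|) = s * (dot w w / 4) by field; rewrite gt_eqF.
  have := lower (s *: w); rewrite !(dotZl, dotZr) => low up.
  have wE : dot w w = - (2 * M) * dot v w - dot p w by rewrite {1}/w dotBl dotZl.
  have : s * (- (2 * M) * dot v w - dot p w) <= s * (M * s * dot w w + dot w w / 4).
    by move: low up; lra.
  rewrite -wE ler_pM2l//.
  have : s * M * dot w w <= 1 / 4 * dot w w by rewrite ler_wpM2r// ltW.
  by lra.
apply: (@differentiable_dot _ _ uT p) => a a0; have [d d0 Hd] := upper _ a0.
pose N : R := M * n%:R + 1; have N0 : 0 < N by rewrite ltr_wpDl// mulr_ge0// ltW.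
exists (Num.min d (a / N)); first by rewrite lt_min d0 divr_gt0.
move=> h; rewrite lt_min ltr_pdivlMr// => /andP[/Hd up ha].
have low := lower h; rewrite ler_norml; apply/andP; split; last by move: up; lra.
have h0 := normr_ge0 h.
have : M * dot h h <= M * (n%:R * `|h| * `|h|).
  by rewrite ler_wpM2l ?(ltW M0)// (le_trans (ler_norm _))// dot_le_norm.
have : `|h| * N * `|h| <= a * `|h| by rewrite ler_wpM2r// ltW.
move: low; rewrite pE dotZl /N; have := mulr_ge0 h0 h0.
by lra.
Qed.

End characteristics.

(** * Initial data that reach a given profile at time T *)

Theorem theorem2p3 (R : realType) (n : nat) (n_gt0 : (0 < n)%N)
  (H : 'rV[R]_n -> R) (H_C2 : Ck 2 H)
  (H_convex : forall p : 'rV[R]_n, posdefmx (hessian H p))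
  (H_superlinear : superlinear H)
  (T : R) (T_gt0 : 0 < T)
  (uT : 'rV[R]_n -> R) (uT_lip : lipschitz uT)
  (I_nonempty : initial_data H T uT !=set0)
  (u0 : 'rV[R]_n -> R) (u0_lip : lipschitz u0) :
  initial_data H T uT u0 <->
  (forall x, Sminus H T uT x <= u0 x) /\
  (forall x, contact_set H T uT x -> u0 x = Sminus H T uT x).
Proof.
have [H_diff _] := H_C2.
have H_cont : continuous H by move=> p; exact: differentiable_continuous.
have H_conv := Ck2_strictly_convex H_C2 H_convex.
have H_growth := superlinear_growth H_cont H_superlinear.
have [KT KT0 uT_K] := lipschitz_bound uT_lip.
have S_ge := Sminus_ge H_cont H_conv H_growth KT0 uT_K T_gt0.
(* Stated for every [v], because the converse applies it to the element provided by nonemptiness. *)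
have forward v : initial_data H T uT v ->
    (forall x, Sminus H T uT x <= v x) /\
    (forall x, contact_set H T uT x -> v x = Sminus H T uT x).
  move=> [v_lip vuT]; have [K K0 v_K] := lipschitz_bound v_lip.
  have vE := Splus_hopf_lax H_cont H_conv H_growth K0 v_K T_gt0.
  rewrite vuT in vE.
  have Sv x : Sminus H T uT x <= v x.
    have [q ->] := Sminus_attained H_cont H_conv H_growth KT0 uT_K T_gt0 x.
    rewrite vE lerBlDr.
    have := hopf_lax_le H_cont H_conv H_growth K0 v_K (x + T *: q) q (ltW T_gt0).
    by rewrite addrK.
  split=> // _ [z /= duT <-]; apply: le_anti; rewrite Sv andbT.
  have [q qmin] := hopf_lax_attained H_cont H_conv H_growth K0 v_K z (ltW T_gt0).
  have duT' : differentiable (hopf_lax H v T) z by rewrite -vE.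
  have qE := minimizer_grad H_diff H_conv H_growth K0 v_K T_gt0 duT' qmin.
  rewrite vE -qE; have := S_ge (z - T *: q) q.
  by rewrite subrK {1}vE qmin; rewrite -vE; lra.
split; first exact: forward.
move=> [Su0 Su0_eq]; split=> //.
have [v vI] := I_nonempty; have [_ v_eq] := forward v vI.
have [v_lip vuT] := vI; have [K K0 v_K] := lipschitz_bound v_lip.
have vE := Splus_hopf_lax H_cont H_conv H_growth K0 v_K T_gt0; rewrite vuT in vE.
have [K1 K10 u0_K] := lipschitz_bound u0_lip.
rewrite (Splus_hopf_lax H_cont H_conv H_growth K10 u0_K T_gt0).
have u0_lipx x y := hopf_lax_lip H_cont H_conv H_growth K10 u0_K x y (ltW T_gt0).
apply/funext => z0; apply: le_anti; apply/andP; split; last first.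
  (* Domination alone gives this half: at the starting point of the optimal ray, [u0] is at least
     [Sminus], hence at least [uT z0 - T * L q]. *)
  have [q ->] := hopf_lax_attained H_cont H_conv H_growth K10 u0_K z0 (ltW T_gt0).
  have := S_ge (z0 - T *: q) q; have := Su0 (z0 - T *: q); rewrite subrK; lra.
(* The minimiser for [v] at [z] starts from a contact point, where [u0] and [v] both equal [Sminus];
   it is therefore a competitor for [u0] of cost [uT z]. *)
have le_diff z : differentiable uT z -> hopf_lax H u0 T z <= uT z.
  move=> duT; have [q qmin] := hopf_lax_attained H_cont H_conv H_growth K0 v_K z (ltW T_gt0).
  have duT' : differentiable (hopf_lax H v T) z by rewrite -vE.
  have qE := minimizer_grad H_diff H_conv H_growth K0 v_K T_gt0 duT' qmin.
  have zC : contact_set H T uT (z - T *: q).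
    by exists z => //; rewrite qE -vE.
  have := hopf_lax_le H_cont H_conv H_growth K10 u0_K z q (ltW T_gt0).
  by rewrite (Su0_eq _ zC) -(v_eq _ zC) -qmin -vE.
(* Both sides are Lipschitz, with constants [K1] and [KT], so the inequality passes from a dense set
   to [z0]. *)
apply/ler_addgt0Pr => e e0; have N0 : 0 < K1 + KT + 1 by rewrite ltr_wpDl// addr_ge0.
have [z ze duT] := hopf_lax_differentiable_dense H_diff H_conv H_growth K0 v_K T_gt0 z0
  (divr_gt0 e0 N0).
rewrite -vE in duT; have := le_diff z duT; have := u0_lipx z0 z.
have := le_trans (ler_norm _) (uT_K z z0).
move: ze; rewrite ltr_pdivlMr// (distrC z0).
by have := normr_ge0 (z - z0); lra.
Qed.
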